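(* Let $\mathcal{A}\in\mathbb{R}^{N_1\times N_2\times N_3}$ and $\mathcal{B}\in\mathbb{R}^{N_1\times K\times N_3}$. Let $f:\mathbb{R}^{N_2\times K\times N_3}\to\mathbb{R}$ be $\gamma$-strongly convex ($\gamma>0$) and strongly admissible (with respect to $\mathcal{A},\mathcal{B}$). Let $\widehat{\mathcal{X}}$ be the solution of $$\min_{\mathcal{X}\in\mathbb{R}^{N_2\times K\times N_3}} f(\mathcal{X})\quad\text{s.t.}\quad \mathcal{A}^\top*\mathcal{A}*\mathcal{X}=\mathcal{A}^\top*\mathcal{B},$$ and let $\nu>0$ be a constant such that $$D_{f,\mathcal{Z}}(\mathcal{X},\widehat{\mathcal{X}})\le \frac1\nu\|\mathcal{A}*(\mathcal{X}-\widehat{\mathcal{X}})\|_{\rm F}^2\quad\text{for all }\mathcal{X}\in\mathbb{R}^{N_2\times K\times N_3}\text{ and all }\mathcal{Z}\in\partial f(\mathcal{X})\cap\mathrm{range}_K(\mathcal{A}^\top).$$ Assume that $0<\alpha_{\rm c}<2/\lambda_{\rm c}$ and $0<\alpha_{\rm r}<2\gamma/\lambda_{\rm r}$. Then for any $\delta>0$, the sequences $\{\mathcal{X}^{(k)}\}$ and $\{\mathcal{Y}^{(k)}\}$ generated by the RREK algorithm (defined in the context) satisfy, for every $k$, $$\mathbb{E}\big[D_{f,\mathcal{Y}^{(k)}}(\mathcal{X}^{(k)},\widehat{\mathcal{X}})\big]\le \frac{\delta+\gamma}{2\delta\gamma}\,\frac{\alpha_{\rm r}^2\lambda_{\rm r}}{\|\mathcal{A}\|_{\rm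 F}^2}\,\|\mathcal{A}*\mathcal{A}^\dagger*\mathcal{B}\|_{\rm F}^2\sum_{i=0}^{k-1}\rho_{\rm c}^{k-i}\Big(1+\frac{\delta}{\gamma}\Big)^i\rho_{\rm r}^i+\Big(1+\frac{\delta}{\gamma}\Big)^k\rho_{\rm r}^k\,D_{f,\mathcal{Y}^{(0)}}(\mathcal{X}^{(0)},\widehat{\mathcal{X}}),$$ where $$\rho_{\rm c}=1-\frac{(2\alpha_{\rm c}-\alpha_{\rm c}^2\lambda_{\rm c})\,\sigma_{\min}^2(\mathrm{bcirc}(\mathcal{A}))}{\|\mathcal{A}\|_{\rm F}^2},\qquad \rho_{\rm r}=1-\frac{(2\gamma\alpha_{\rm r}-\alpha_{\rm r}^2\lambda_{\rm r})\,\nu}{2\gamma\|\mathcal{A}\|_{\rm F}^2}.$$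
   Context: Tensor notation. For $\mathcal{A}\in\mathbb{R}^{N_1\times N_2\times N_3}$, $\mathcal{A}_{i,:,:}$ (a $1\times N_2\times N_3$ tensor), $\mathcal{A}_{:,j,:}$ (an $N_1\times1\times N_3$ tensor) and $\mathbf{A}_k=\mathcal{A}_{:,:,k}$ (an $N_1\times N_2$ matrix) denote its $i$th horizontal, $j$th lateral and $k$th frontal slice. $\mathrm{bcirc}(\mathcal{A})\in\mathbb{R}^{N_1N_3\times N_2N_3}$ is the block circulant matrix whose $(p,q)$ block is $\mathbf{A}_{((p-q)\bmod N_3)+1}$ (first block column $\mathbf{A}_1,\mathbf{A}_2,\dots,\mathbf{A}_{N_3}$). $\mathrm{unfold}(\mathcal{A})\in\mathbb{R}^{N_1N_3\times N_2}$ stacks the frontal slices $\mathbf{A}_1,\dots,\mathbf{A}_{N_3}$ vertically, and $\mathrm{fold}$ is its inverse. The t-product of $\mathcal{A}\in\mathbb{R}^{N_1\times N_2\times N_3}$ and $\mathcal{B}\in\mathbb{R}^{N_2\times K\times N_3}$ is $\mathcal{A}*\mathcal{B}=\mathrm{fold}(\mathrm{bcirc}(\mathcal{A})\,\mathrm{unfold}(\mathcal{B}))\in\mathbb{R}^{N_1\times K\times N_3}$. The transpose $\mathcal{A}^\top\in\mathbb{R}^{N_2\times N_1\times N_3}$ is obtained by transposing each frontal slice and then reversing the order of the transposed frontal slices $2$ through $N_3$. The pseudoinverse $\mathcal{A}^\dagger\in\mathbb{R}^{N_2\times N_1\times N_3}$ is the tensor with $\mathrm{bcirc}(\mathcal{A}^\dagger)=\mathrm{bcirc}(\mathcal{A})^\dagger$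 (Moore--Penrose). $\langle\mathcal{A},\mathcal{B}\rangle=\sum_{i,j,k}\mathcal{A}_{ijk}\mathcal{B}_{ijk}$, $\|\mathcal{A}\|_{\rm F}=\sqrt{\langle\mathcal{A},\mathcal{A}\rangle}$, $\|\mathcal{A}\|_2=\|\mathrm{bcirc}(\mathcal{A})\|_2$ (matrix spectral norm). $\mathrm{range}_K(\mathcal{A}^\top)=\{\mathcal{A}^\top*\mathcal{Y}:\mathcal{Y}\in\mathbb{R}^{N_1\times K\times N_3}\}$. $\sigma_{\min}(\cdot)$ denotes the minimum nonzero singular value of a matrix. Convex analysis (on tensor spaces with the inner product $\langle\mathcal{X},\mathcal{Y}\rangle=\sum_{i,j,k}\mathcal{X}_{ijk}\mathcal{Y}_{ijk}$). $\partial f(\mathcal{X})=\{\mathcal{Z}: f(\mathcal{Y})\ge f(\mathcal{X})+\langle\mathcal{Z},\mathcal{Y}-\mathcal{X}\rangle\ \forall\mathcal{Y}\}$. $f$ is $\gamma$-strongly convex if $f(\mathcal{Y})\ge f(\mathcal{X})+\langle\mathcal{Z},\mathcal{Y}-\mathcal{X}\rangle+\frac\gamma2\|\mathcal{Y}-\mathcal{X}\|_{\rm F}^2$ for all $\mathcal{X},\mathcal{Y}$ and $\mathcal{Z}\in\partial f(\mathcal{X})$ (here $f$ is real-valued, continuous and convex). The conjugate is $f^*(\mathcal{Y})=\sup_{\mathcal{X}}\{\langle\mathcal{Y},\mathcal{X}\rangle-f(\mathcal{X})\}$; for strongly convex $f$ it is differentiable, and $\mathcal{Z}\in\partial f(\mathcal{X})\Leftrightarrow\mathcal{X}=\nabla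 f^*(\mathcal{Z})$. For $\mathcal{Z}\in\partial f(\mathcal{X})$ the Bregman distance is $D_{f,\mathcal{Z}}(\mathcal{X},\mathcal{Y})=f(\mathcal{Y})-f(\mathcal{X})-\langle\mathcal{Z},\mathcal{Y}-\mathcal{X}\rangle$. A convex differentiable function $g$ with nonempty minimizer set $X_g$ is restricted strongly convex if there is $\mu>0$ with $\langle\nabla g(P_{X_g}(\mathcal{X}))-\nabla g(\mathcal{X}),P_{X_g}(\mathcal{X})-\mathcal{X}\rangle\ge\mu\|P_{X_g}(\mathcal{X})-\mathcal{X}\|_{\rm F}^2$ for all $\mathcal{X}$, where $P_{X_g}$ is the orthogonal projection onto $X_g$. A strongly convex $f:\mathbb{R}^{N_2\times K\times N_3}\to\mathbb{R}$ is strongly admissible (with respect to $\mathcal{A},\mathcal{B}$) if $g(\mathcal{Y})=f^*(\mathcal{A}^\top*\mathcal{A}*\mathcal{Y})-\langle\mathcal{Y},\mathcal{A}^\top*\mathcal{B}\rangle$ is restricted strongly convex on $\mathbb{R}^{N_2\times K\times N_3}$. Constants. $\lambda_{\rm r}=\max_{1\le i\le N_1}\|\mathcal{A}_{i,:,:}\|_2^2/\|\mathcal{A}_{i,:,:}\|_{\rm F}^2$ and $\lambda_{\rm c}=\max_{1\le j\le N_2}\|\mathcal{A}_{:,j,:}\|_2^2/\|\mathcal{A}_{:,j,:}\|_{\rm F}^2$; all horizontal and lateral slices of $\mathcal{A}$ are taken to be nonzero so that these are well defined. RREK algorithm with stepsizes $\alpha_{\rm r},\alpha_{\rm c}$ (run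 without stopping criterion). Initialize $\mathcal{Z}^{(0)}=\mathcal{B}$, a deterministic $\mathcal{Y}^{(0)}\in\mathrm{range}_K(\mathcal{A}^\top)$, $\mathcal{X}^{(0)}=\nabla f^*(\mathcal{Y}^{(0)})$. For $k=1,2,\dots$: pick $j_k\in\{1,\dots,N_2\}$ with probability $\|\mathcal{A}_{:,j_k,:}\|_{\rm F}^2/\|\mathcal{A}\|_{\rm F}^2$ and set $$\mathcal{Z}^{(k)}=\mathcal{Z}^{(k-1)}-\alpha_{\rm c}\,\mathcal{A}_{:,j_k,:}*\frac{(\mathcal{A}_{:,j_k,:})^\top*\mathcal{Z}^{(k-1)}}{\|\mathcal{A}_{:,j_k,:}\|_{\rm F}^2};$$ pick $i_k\in\{1,\dots,N_1\}$ with probability $\|\mathcal{A}_{i_k,:,:}\|_{\rm F}^2/\|\mathcal{A}\|_{\rm F}^2$ and set $$\mathcal{Y}^{(k)}=\mathcal{Y}^{(k-1)}-\alpha_{\rm r}(\mathcal{A}_{i_k,:,:})^\top*\frac{\mathcal{A}_{i_k,:,:}*\mathcal{X}^{(k-1)}-\mathcal{B}_{i_k,:,:}+\mathcal{Z}^{(k)}_{i_k,:,:}}{\|\mathcal{A}_{i_k,:,:}\|_{\rm F}^2},\qquad \mathcal{X}^{(k)}=\nabla f^*(\mathcal{Y}^{(k)}).$$ All random indices $j_1,i_1,j_2,i_2,\dots$ are mutually independent. *)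

(* Defs.v *)
From HB Require Import structures.
From mathcomp Require Import all_boot all_order all_algebra.
From mathcomp Require Import all_classical all_reals all_analysis.

Set Implicit Arguments.
Unset Strict Implicit.
Unset Printing Implicit Defensive.

Import Order.TTheory GRing.Theory Num.Theory.
Import numFieldNormedType.Exports.

Local Open Scope classical_set_scope.
Local Open Scope ring_scope.

Section Matrix.
Context {R : realType}.

Definition enorm n (x : 'cV[R]_n) : R := Num.sqrt (\sum_i x i 0 ^+ 2).

Definition spectral_norm m n (M : 'M[R]_(m, n)) : R :=
  sup [set enorm (M *m x) | x in [set x : 'cV[R]_n | enorm x <= 1]].

Definition singular_value m n (M : 'M[R]_(m, n)) (s : R) : Prop :=
  0 <= s /\ eigenvalue (M^T *m M) (s ^+ 2).

(* The set is finite, and nonempty as soon as M != 0, so [inf] is a minimum. *)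
Definition sigma_min m n (M : 'M[R]_(m, n)) : R :=
  inf [set s | singular_value M s /\ s != 0].

Definition moore_penrose m n (M : 'M[R]_(m, n)) (P : 'M[R]_(n, m)) : Prop :=
  [/\ M *m P *m M = M, P *m M *m P = P,
      (M *m P)^T = M *m P & (P *m M)^T = P *m M].

(* Every real matrix has exactly one Moore--Penrose inverse. *)
Definition mpinv m n (M : 'M[R]_(m, n)) : 'M[R]_(n, m) :=
  xget 0 [set P | moore_penrose M P].

End Matrix.

(* Row k stores the vectorization of the k-th frontal slice.  This encoding
   makes the tensor space a normed module (its norm is the entrywise maximum,
   hence equivalent to the Frobenius norm), so that [continuous] and
   [differentiable] apply to functions of a tensor. *)
Definition tensor (R : realType) (n1 n2 n3 : nat) : Type := 'M[R]_(n3, n1 * n2).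

#[warning="-redundant-canonical-projection"]
HB.instance Definition _ (R : realType) (n1 n2 n3 : nat) :=
  NormedModule.on (tensor R n1 n2 n3).

Section Tensor.
Context {R : realType}.

Definition frontal n1 n2 n3 (A : tensor R n1 n2 n3) (k : 'I_n3) :
    'M[R]_(n1, n2) :=
  vec_mx (row k A).

Definition of_frontal n1 n2 n3 (F : 'I_n3 -> 'M[R]_(n1, n2)) :
    tensor R n1 n2 n3 :=
  \matrix_(k < n3) mxvec (F k).

Definition hslice n1 n2 n3 (A : tensor R n1 n2 n3) (i : 'I_n1) :
    tensor R 1 n2 n3 :=
  of_frontal (fun k => row i (frontal A k)).

Definition lslice n1 n2 n3 (A : tensor R n1 n2 n3) (j : 'I_n2) :
    tensor R n1 1 n3 :=
  of_frontal (fun k => col j (frontal A k)).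

(* The subtraction is that of the group 'I_n3.+1, i.e. modulo n3.+1. *)
Definition bcirc n1 n2 n3 (A : tensor R n1 n2 n3.+1) :
    'M[R]_(\sum_(p < n3.+1) n1, \sum_(q < n3.+1) n2) :=
  \mxblock_(p < n3.+1, q < n3.+1) frontal A (p - q).

Definition unfold n1 n2 n3 (A : tensor R n1 n2 n3) :
    'M[R]_(\sum_(p < n3) n1, n2) :=
  \mxcol_(k < n3) frontal A k.

Definition fold n1 n2 n3 (M : 'M[R]_(\sum_(p < n3) n1, n2)) :
    tensor R n1 n2 n3 :=
  of_frontal (fun k => submxcol M k).

Definition tprod n1 n2 m n3 (A : tensor R n1 n2 n3.+1)
    (B : tensor R n2 m n3.+1) : tensor R n1 m n3.+1 :=
  fold (bcirc A *m unfold B).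

(* With 0-based indices, reversing the transposed slices 1, ..., n3 while
   fixing slice 0 ridx k |-> - k modulo n3.+1. *)
Definition ttr n1 n2 n3 (A : tensor R n1 n2 n3.+1) : tensor R n2 n1 n3.+1 :=
  of_frontal (fun k => (frontal A (- k))^T).

(* The Moore--Penrose inverse of a block circulant matrix is block circulant,
   and [bcirc] is injective: exactly one tensor qualifies. *)
Definition tpinv n1 n2 n3 (A : tensor R n1 n2 n3.+1) : tensor R n2 n1 n3.+1 :=
  xget 0 [set P : tensor R n2 n1 n3.+1 | bcirc P = mpinv (bcirc A)].

Definition tdot n1 n2 n3 (A B : tensor R n1 n2 n3) : R :=
  \sum_k \sum_i \sum_j frontal A k i j * frontal B k i j.

Definition tnormF n1 n2 n3 (A : tensor R n1 n2 n3) : R := Num.sqrt (tdot A A).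

Definition tnorm2 n1 n2 n3 (A : tensor R n1 n2 n3.+1) : R :=
  spectral_norm (bcirc A).

(* range_m(A^T), the number m of lateral slices being left implicit. *)
Definition range_tr m n1 n2 n3 (A : tensor R n1 n2 n3.+1) :
    set (tensor R n2 m n3.+1) :=
  [set tprod (ttr A) Y | Y in [set: tensor R n1 m n3.+1]].

Definition lambda_r n1 n2 n3 (A : tensor R n1 n2 n3.+1) : R :=
  \big[Num.max/0]_(i < n1) (tnorm2 (hslice A i) ^+ 2 / tnormF (hslice A i) ^+ 2).

Definition lambda_c n1 n2 n3 (A : tensor R n1 n2 n3.+1) : R :=
  \big[Num.max/0]_(j < n2) (tnorm2 (lslice A j) ^+ 2 / tnormF (lslice A j) ^+ 2).

End Tensor.

Section Convex.
Context {R : realType} {n1 n2 n3 : nat}.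
Local Notation T := (tensor R n1 n2 n3).
Implicit Types (f g : T -> R) (X Y Z : T).

Definition subdiff f X : set T :=
  [set Z | forall Y, f Y >= f X + tdot Z (Y - X)].

Definition strongly_convex (gamma : R) f : Prop :=
  [/\ convex_function [set: T] f, continuous f &
      forall X Y Z, subdiff f X Z ->
        f Y >= f X + tdot Z (Y - X) + gamma / 2 * tnormF (Y - X) ^+ 2].

(* A real-valued [sup]: for strongly convex f the supremum is finite. *)
Definition conjugate f Y : R := sup [set tdot Y X - f X | X in [set: T]].

(* Representative of the Frechet differential for the Frobenius inner product
   (0 where f is not differentiable). *)
Definition gradient f X : T :=
  xget 0 [set G : T | differentiable f X /\ forall H : T, 'd f X H = tdot G H].

Definition bregman f Z X Y : R := f Y - f X - tdot Z (Y - X).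

Definition minimizers g : set T := [set X | forall Y, g X <= g Y].

Definition is_projection (S : set T) X P : Prop :=
  S P /\ forall Q, S Q -> tnormF (X - P) <= tnormF (X - Q).

Definition proj (S : set T) X : T := xget 0 [set P | is_projection S X P].

Definition restricted_strongly_convex g : Prop :=
  [/\ convex_function [set: T] g, forall X, differentiable g X,
      minimizers g !=set0 &
      exists2 mu : R, 0 < mu &
        forall X, let P := proj (minimizers g) X in
          tdot (gradient g P - gradient g X) (P - X) >= mu * tnormF (P - X) ^+ 2].

End Convex.

Section LeastSquares.
Context {R : realType} {n1 n2 n3 m : nat}.
Variables (A : tensor R n1 n2 n3.+1) (B : tensor R n1 m n3.+1).
Variable f : tensor R n2 m n3.+1 -> R.

Definition strongly_admissible : Prop :=
  restricted_strongly_convex (fun Y : tensor R n2 m n3.+1 =>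
    conjugate f (tprod (tprod (ttr A) A) Y) - tdot Y (tprod (ttr A) B)).

Definition feasible (X : tensor R n2 m n3.+1) : Prop :=
  tprod (tprod (ttr A) A) X = tprod (ttr A) B.

Definition is_solution (Xhat : tensor R n2 m n3.+1) : Prop :=
  feasible Xhat /\ forall X, feasible X -> f Xhat <= f X.

(* [cidx k] and [ridx k] are the indices drawn at iteration k.+1. *)
Variables (alpha_c alpha_r : R) (Y0 : tensor R n2 m n3.+1).
Variables (cidx : nat -> 'I_n2) (ridx : nat -> 'I_n1).

Fixpoint rrekZ (k : nat) : tensor R n1 m n3.+1 :=
  if k is k'.+1 then
    let Aj := lslice A (cidx k') in
    rrekZ k' - alpha_c *:
      tprod Aj ((tnormF Aj ^+ 2)^-1 *: tprod (ttr Aj) (rrekZ k'))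
  else B.

Fixpoint rrekY (k : nat) : tensor R n2 m n3.+1 :=
  if k is k'.+1 then
    let Ai := hslice A (ridx k') in
    let Xk' := gradient (conjugate f) (rrekY k') in
    rrekY k' - alpha_r *:
      tprod (ttr Ai) ((tnormF Ai ^+ 2)^-1 *:
        (tprod Ai Xk' - hslice B (ridx k') + hslice (rrekZ k'.+1) (ridx k')))
  else Y0.

Definition rrekX (k : nat) : tensor R n2 m n3.+1 :=
  gradient (conjugate f) (rrekY k).

End LeastSquares.

Section Random.
Context {d : measure_display} {Om : measurableType d} {R : realType}.
Variable P : probability Om R.

(* Measurability is for the discrete sigma-algebra on 'I_n. *)
Definition random_index_with_law n (u : Om -> 'I_n) (p : 'I_n -> R) : Prop :=
  forall i, measurable [set w | u w = i] /\ P [set w | u w = i] = (p i)%:E.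

(* Product rule over every finite subfamily of the combined family
   j 0, i 0, j 1, i 1, ... *)
Definition mutually_independent n1 n2
    (j : nat -> Om -> 'I_n2) (i : nat -> Om -> 'I_n1) : Prop :=
  forall (s t : seq nat) (E : nat -> {set 'I_n2}) (F : nat -> {set 'I_n1}),
    uniq s -> uniq t ->
    P ((\bigcap_(k in [set` s]) [set w | j k w \in E k]) `&`
       (\bigcap_(k in [set` t]) [set w | i k w \in F k])) =
    ((\prod_(k <- s) P [set w | j k w \in E k]) *
     (\prod_(k <- t) P [set w | i k w \in F k]))%E.

Definition rrek_sampling n1 n2 n3 (A : tensor R n1 n2 n3)
    (j : nat -> Om -> 'I_n2) (i : nat -> Om -> 'I_n1) : Prop :=
  [/\ forall k, random_index_with_law (j k)
        (fun c => tnormF (lslice A c) ^+ 2 / tnormF A ^+ 2),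
      forall k, random_index_with_law (i k)
        (fun r => tnormF (hslice A r) ^+ 2 / tnormF A ^+ 2) &
      mutually_independent j i].

End Random.

(* Main.v *)
(** Subtract from the column iterates the component of B orthogonal to the range
    of A: the remainder W stays in that range, where |A^T * W| dominates
    sigma_min |W|, so one averaged column step contracts |W|^2 by rho_c.  A row
    step is an exact step for the consistent system A * X = A * Xhat, which
    contracts the Bregman distance by rho_r, plus a perturbation driven by W;
    smoothness of the conjugate and Young's inequality split the two at the cost
    of the factor 1 + delta / gamma.  Unrolling the two coupled recursions gives
    the bound; it uses rho_c, rho_r >= 0, which follow from the one-step
    estimates themselves. *)

Require Import Defs.
From HB Require Import structures.
From mathcomp Require Import all_boot all_order all_algebra.
From mathcomp Require Import all_classical all_reals all_analysis.
From mathcomp Require Import ring lra.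

Set Implicit Arguments.
Unset Strict Implicit.
Unset Printing Implicit Defensive.

Import Order.TTheory GRing.Theory Num.Theory.
Import numFieldNormedType.Exports.

Local Open Scope classical_set_scope.
Local Open Scope ring_scope.

(** An iterate at step k depends only on the first k draws of each index sequence, so it takes
    finitely many values. Expectations become finite weighted sums over index histories, and
    conditional expectation becomes an inner sum over one fresh pair of draws; measurability is only
    ever checked for events about the indices.

    The gradient of the conjugate is a choice with default 0, so it says nothing until
    differentiability is proved. Subgradients are produced by minimizing coercive functions; strong
    convexity then pins the conjugate between its tangent and that tangent plus a quadratic with
    coefficient 1/(2 gamma). This sandwich gives both the differentiability and the smoothness used
    in the row step. *)

(** * Tensor algebra *)

Section TensorAlgebra.
Context {R : realType}.

Lemma frontalE n1 n2 n3 (A : tensor R n1 n2 n3) k i j :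
  frontal A k i j = A k (mxvec_index i j).
Proof. by rewrite !mxE. Qed.

Lemma frontal_of_frontal n1 n2 n3 (F : 'I_n3 -> 'M[R]_(n1, n2)) k :
  frontal (of_frontal F) k = F k.
Proof. by rewrite /frontal rowK mxvecK. Qed.

Lemma frontalP n1 n2 n3 (A B : tensor R n1 n2 n3) :
  (forall k, frontal A k = frontal B k) -> A = B.
Proof.
move=> AB; apply/row_matrixP => k.
by apply: (can_inj vec_mxK); exact: AB.
Qed.

Lemma frontal0 n1 n2 n3 k : frontal (0 : tensor R n1 n2 n3) k = 0.
Proof. by rewrite /frontal !linear0. Qed.

Lemma frontalD n1 n2 n3 (A B : tensor R n1 n2 n3) k :
  frontal (A + B) k = frontal A k + frontal B k.
Proof. by rewrite /frontal !linearD. Qed.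

Lemma frontalN n1 n2 n3 (A : tensor R n1 n2 n3) k :
  frontal (- A) k = - frontal A k.
Proof. by rewrite /frontal !linearN. Qed.

Lemma frontalZ n1 n2 n3 a (A : tensor R n1 n2 n3) k :
  frontal (a *: A) k = a *: frontal A k.
Proof. by rewrite /frontal !linearZ. Qed.

Lemma foldK n1 n2 n3 (M : 'M[R]_(\sum_(p < n3) n1, n2)) :
  unfold (fold M) = M.
Proof.
by rewrite -[RHS]submxcolK; apply: eq_mxcol => k; rewrite frontal_of_frontal.
Qed.

Lemma unfold_tprod n1 n2 m n3 (A : tensor R n1 n2 n3.+1)
    (B : tensor R n2 m n3.+1) : unfold (tprod A B) = bcirc A *m unfold B.
Proof. exact: foldK. Qed.

Lemma frontal_tprod n1 n2 m n3 (A : tensor R n1 n2 n3.+1)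
    (B : tensor R n2 m n3.+1) k :
  frontal (tprod A B) k = \sum_l frontal A (k - l) *m frontal B l.
Proof.
rewrite /tprod frontal_of_frontal mul_mxblock_mxrow.
by rewrite mxcolK.
Qed.

Lemma frontal_ttr n1 n2 n3 (A : tensor R n1 n2 n3.+1) k :
  frontal (ttr A) k = (frontal A (- k))^T.
Proof. exact: frontal_of_frontal. Qed.

(** Together with [bcirc_ttr] and [bcirc_inj], this reduces identities between t-products to matrix
    identities. *)
Lemma bcirc_tprod n1 n2 m n3 (A : tensor R n1 n2 n3.+1)
    (B : tensor R n2 m n3.+1) : bcirc (tprod A B) = bcirc A *m bcirc B.
Proof.
rewrite mul_mxblock; apply: eq_mxblock => p q; rewrite frontal_tprod.
rewrite (reindex_inj (addIr (- q))) /=; apply: eq_bigr => l _.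
by rewrite opprB addrA addrNK.
Qed.

Lemma bcirc_ttr n1 n2 n3 (A : tensor R n1 n2 n3.+1) :
  bcirc (ttr A) = (bcirc A)^T.
Proof.
by rewrite tr_mxblock; apply: eq_mxblock => p q; rewrite frontal_ttr opprB.
Qed.

Lemma bcirc_inj n1 n2 n3 : injective (@bcirc R n1 n2 n3).
Proof.
move=> A B AB; apply: frontalP => k.
have /eq_mxblockP/(_ k 0) : \mxblock_(p, q) frontal A (p - q) =
  \mxblock_(p, q) frontal B (p - q) by exact: AB.
by rewrite subr0.
Qed.

Lemma tprodA n1 n2 n m n3 (A : tensor R n1 n2 n3.+1)
    (B : tensor R n2 n n3.+1) (C : tensor R n m n3.+1) :
  tprod A (tprod B C) = tprod (tprod A B) C.
Proof. by apply: bcirc_inj; rewrite !bcirc_tprod mulmxA. Qed.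

Lemma ttr_tprod n1 n2 m n3 (A : tensor R n1 n2 n3.+1)
    (B : tensor R n2 m n3.+1) : ttr (tprod A B) = tprod (ttr B) (ttr A).
Proof. by apply: bcirc_inj; rewrite !(bcirc_tprod, bcirc_ttr) trmx_mul. Qed.

Lemma ttrK n1 n2 n3 (A : tensor R n1 n2 n3.+1) : ttr (ttr A) = A.
Proof. by apply: bcirc_inj; rewrite !bcirc_ttr trmxK. Qed.

Section TprodLinear.
Variables (n1 n2 m n3 : nat) (A : tensor R n1 n2 n3.+1).
Implicit Types B C : tensor R n2 m n3.+1.

Lemma tprodDr B C : tprod A (B + C) = tprod A B + tprod A C.
Proof.
apply: frontalP => k; rewrite frontalD !frontal_tprod -big_split.
by apply: eq_bigr => l _; rewrite frontalD mulmxDr.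
Qed.

Lemma tprodNr B : tprod A (- B) = - tprod A B.
Proof.
apply: frontalP => k; rewrite frontalN !frontal_tprod -sumrN.
by apply: eq_bigr => l _; rewrite frontalN mulmxN.
Qed.

Lemma tprodBr B C : tprod A (B - C) = tprod A B - tprod A C.
Proof. by rewrite tprodDr tprodNr. Qed.

Lemma tprodZr a B : tprod A (a *: B) = a *: tprod A B.
Proof.
apply: frontalP => k; rewrite frontalZ !frontal_tprod scaler_sumr.
by apply: eq_bigr => l _; rewrite frontalZ -scalemxAr.
Qed.

Lemma tprod0r : tprod A (0 : tensor R n2 m n3.+1) = 0.
Proof. by rewrite -[X in tprod _ X](subrr 0) tprodBr subrr. Qed.

End TprodLinear.

(** T-products with such a tensor act slicewise, so taking a horizontal or lateral slice is itself a
    t-product ([hsliceE], [lsliceE]) and commutes with t-products by associativity. *)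
Definition tdiag n1 n2 n3 (M : 'M[R]_(n1, n2)) : tensor R n1 n2 n3.+1 :=
  of_frontal (fun k => if k == 0 then M else 0).

Lemma frontal_tdiag_tprod n1 n2 m n3 (M : 'M[R]_(n1, n2))
    (A : tensor R n2 m n3.+1) k :
  frontal (tprod (tdiag n3 M) A) k = M *m frontal A k.
Proof.
rewrite frontal_tprod (bigD1 k)//= frontal_of_frontal subrr eqxx big1 ?addr0//.
by move=> l /negPf lk; rewrite frontal_of_frontal subr_eq0 eq_sym lk mul0mx.
Qed.

Lemma frontal_tprod_tdiag n1 n2 m n3 (A : tensor R n1 n2 n3.+1)
    (M : 'M[R]_(n2, m)) k :
  frontal (tprod A (tdiag n3 M)) k = frontal A k *m M.
Proof.
rewrite frontal_tprod (bigD1 0)//= frontal_of_frontal eqxx subr0.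
rewrite big1 ?addr0// => l /negPf l0.
by rewrite frontal_of_frontal l0 mulmx0.
Qed.

Lemma tprod1r n1 n2 n3 (A : tensor R n1 n2 n3.+1) :
  tprod A (tdiag n3 1%:M) = A.
Proof. by apply: frontalP => k; rewrite frontal_tprod_tdiag mulmx1. Qed.

Lemma hsliceE n1 n2 n3 (A : tensor R n1 n2 n3.+1) i :
  hslice A i = tprod (tdiag n3 (delta_mx 0 i)) A.
Proof.
apply: frontalP => k.
by rewrite frontal_of_frontal frontal_tdiag_tprod -rowE.
Qed.

Lemma lsliceE n1 n2 n3 (A : tensor R n1 n2 n3.+1) j :
  lslice A j = tprod A (tdiag n3 (delta_mx j 0)).
Proof.
apply: frontalP => k.
by rewrite frontal_of_frontal frontal_tprod_tdiag -colE.
Qed.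

Lemma hslice_tprod n1 n2 m n3 (A : tensor R n1 n2 n3.+1)
    (B : tensor R n2 m n3.+1) i : hslice (tprod A B) i = tprod (hslice A i) B.
Proof. by rewrite !hsliceE tprodA. Qed.

Lemma ttr_lslice n1 n2 n3 (A : tensor R n1 n2 n3.+1) j :
  ttr (lslice A j) = hslice (ttr A) j.
Proof.
apply: frontalP => k.
by rewrite frontal_ttr !frontal_of_frontal tr_col.
Qed.

Section InnerProduct.
Variables n1 n2 n3 : nat.
Implicit Types A B C : tensor R n1 n2 n3.

Lemma tdotC A B : tdot A B = tdot B A.
Proof.
apply: eq_bigr => k _; apply: eq_bigr => i _; apply: eq_bigr => j _.
exact: mulrC.
Qed.

Lemma tdotDr A B C : tdot A (B + C) = tdot A B + tdot A C.
Proof.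
rewrite -big_split; apply: eq_bigr => k _; rewrite -big_split.
apply: eq_bigr => i _; rewrite -big_split; apply: eq_bigr => j _ /=.
by rewrite frontalD [X in _ * X]mxE mulrDr.
Qed.

Lemma tdotZr a A B : tdot A (a *: B) = a * tdot A B.
Proof.
rewrite mulr_sumr; apply: eq_bigr => k _; rewrite mulr_sumr.
apply: eq_bigr => i _; rewrite mulr_sumr; apply: eq_bigr => j _ /=.
by rewrite frontalZ [X in _ * X]mxE mulrCA.
Qed.

Lemma tdotNr A B : tdot A (- B) = - tdot A B.
Proof. by rewrite -scaleN1r tdotZr mulN1r. Qed.

Lemma tdotBr A B C : tdot A (B - C) = tdot A B - tdot A C.
Proof. by rewrite tdotDr tdotNr. Qed.

Lemma tdotDl A B C : tdot (A + B) C = tdot A C + tdot B C.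
Proof. by rewrite !(tdotC _ C) tdotDr. Qed.

Lemma tdotZl a A B : tdot (a *: A) B = a * tdot A B.
Proof. by rewrite !(tdotC _ B) tdotZr. Qed.

Lemma tdotNl A B : tdot (- A) B = - tdot A B.
Proof. by rewrite !(tdotC _ B) tdotNr. Qed.

Lemma tdotBl A B C : tdot (A - B) C = tdot A C - tdot B C.
Proof. by rewrite tdotDl tdotNl. Qed.

Lemma tdot0r A : tdot A 0 = 0.
Proof. by rewrite -(scale0r A) tdotZr mul0r. Qed.

Definition tdot_lin :=
  (tdotDl, tdotDr, tdotNl, tdotNr, tdotZl, tdotZr).

Lemma tdot_ge0 A : 0 <= tdot A A.
Proof.
do 3!apply: sumr_ge0 => ? _; exact: sqr_ge0.
Qed.

Lemma tdot_eq0 A : (tdot A A == 0) = (A == 0).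
Proof.
apply/eqP/eqP => [A0|->]; last exact: tdot0r.
apply: frontalP => k; apply/matrixP => i j; rewrite frontal0 [RHS]mxE.
have ge0 l a b : 0 <= frontal A l a b * frontal A l a b by exact: sqr_ge0.
have s0 l a : 0 <= \sum_b frontal A l a b * frontal A l a b.
  by apply: sumr_ge0 => b _; exact: ge0.
have A1 : \sum_a \sum_b frontal A k a b * frontal A k a b = 0.
  apply: (psumr_eq0P _ A0 (i := k)) => // l _.
  by apply: sumr_ge0 => a _; exact: s0.
have A2 := psumr_eq0P (fun a _ => s0 k a) A1 (i := i) isT.
have /eqP := psumr_eq0P (fun b _ => ge0 k i b) A2 (i := j) isT.
by rewrite mulf_eq0 orbb => /eqP.
Qed.

Lemma tnormF_sqr A : tnormF A ^+ 2 = tdot A A.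
Proof. by rewrite sqr_sqrtr ?tdot_ge0. Qed.

Lemma tnormF_ge0 A : 0 <= tnormF A.
Proof. exact: sqrtr_ge0. Qed.

Lemma tdot_young (c : R) A B : 0 < c ->
  tdot A B <= c / 2 * tdot A A + (2 * c)^-1 * tdot B B.
Proof.
move=> c0; rewrite -subr_ge0.
have -> : c / 2 * tdot A A + (2 * c)^-1 * tdot B B - tdot A B =
    (2 * c)^-1 * tdot (c *: A - B) (c *: A - B).
  by rewrite !tdot_lin (tdotC B A); field; rewrite gt_eqF.
by apply: mulr_ge0 (tdot_ge0 _); rewrite invr_ge0; apply: mulr_ge0; lra.
Qed.

End InnerProduct.

Lemma tdotE n1 n2 n3 (A B : tensor R n1 n2 n3) :
  tdot A B = \sum_k \tr ((frontal A k)^T *m frontal B k).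
Proof.
apply: eq_bigr => k _; rewrite exchange_big; apply: eq_bigr => j _ /=.
by rewrite [RHS]mxE; apply: eq_bigr => i _; rewrite [X in _ = X * _]mxE.
Qed.

(** The reversal of slices in [ttr] is what turns the index k - l of the product into l - k. *)
Lemma tdot_tprodl n1 n2 m n3 (A : tensor R n1 n2 n3.+1)
    (X : tensor R n2 m n3.+1) (Y : tensor R n1 m n3.+1) :
  tdot (tprod A X) Y = tdot X (tprod (ttr A) Y).
Proof.
rewrite !tdotE.
transitivity (\sum_k \sum_l \tr ((frontal X l)^T *m
    ((frontal A (k - l))^T *m frontal Y k))).
  apply: eq_bigr => k _; rewrite frontal_tprod linear_sum mulmx_suml linear_sum.
  by apply: eq_bigr => l _ /=; rewrite trmx_mul mulmxA.
rewrite exchange_big; apply: eq_bigr => l _ /=.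
rewrite frontal_tprod mulmx_sumr linear_sum.
by apply: eq_bigr => k _ /=; rewrite frontal_ttr opprB.
Qed.

Lemma sum_tdot_hslice n1 n2 n3 (A B : tensor R n1 n2 n3) :
  \sum_i tdot (hslice A i) (hslice B i) = tdot A B.
Proof.
rewrite exchange_big; apply: eq_bigr => k _; apply: eq_bigr => i _ /=.
rewrite big_ord1; apply: eq_bigr => j _.
by rewrite !frontal_of_frontal !mxE.
Qed.

Lemma sum_tdot_lslice n1 n2 n3 (A B : tensor R n1 n2 n3) :
  \sum_j tdot (lslice A j) (lslice B j) = tdot A B.
Proof.
rewrite exchange_big; apply: eq_bigr => k _ /=.
rewrite exchange_big; apply: eq_bigr => i _ /=; apply: eq_bigr => j _.
by rewrite big_ord1 !frontal_of_frontal !mxE.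
Qed.

End TensorAlgebra.

(** * Matrix norms, singular values and pseudoinverses *)

(** First-order optimality without limits: if b < 0, the explicit t = - b / d makes the expression
    equal to - t^2 (d - c) < 0. *)
Lemma ge0_of_perturb (R : realFieldType) (b c : R) :
  (forall t, 0 < t -> t <= 1 -> 0 <= t * b + t ^+ 2 * c) -> 0 <= b.
Proof.
move=> h; rewrite leNgt; apply/negP => b0.
have c0 : 0 <= `|c| := normr_ge0 c; have cc := ler_norm c.
pose d := - b + `|c| + 1; have d0 : 0 < d by rewrite /d; lra.
have t0 : 0 < - b / d by apply: divr_gt0 => //; lra.
have db : - b <= d by rewrite /d; lra.
have := h _ t0; rewrite ler_pdivrMr// mul1r => /(_ db).
have -> : - b / d * b + (- b / d) ^+ 2 * c = - ((- b / d) ^+ 2 * (d - c)).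
  by field; rewrite gt_eqF.
rewrite oppr_ge0 leNgt => /negP; apply.
by rewrite mulr_gt0 ?exprn_gt0// /d; lra.
Qed.

(** * Continuity and compactness in matrix spaces *)

Section MatrixTopology.
Context {R : realType}.

Lemma continuous_mx (T : topologicalType) m n (f : T -> 'M[R]_(m, n)) :
  (forall i j, continuous (fun x => f x i j)) -> continuous f.
Proof.
move=> fc x A [P Px PA]; rewrite /nbhs/=.
have : \forall y \near x, forall ij : 'I_m * 'I_n, P ij.1 ij.2 (f y ij.1 ij.2).
  by apply: filter_forall => -[i j]; exact: fc (Px i j).
by apply: filterS => y Py; apply: PA => i j; exact: (Py (i, j)).
Qed.

Lemma continuous_bigsum (T : topologicalType) (I : Type) (r : seq I)
    (F : I -> T -> R) :
  (forall i, continuous (F i)) -> continuous (fun x => \sum_(i <- r) F i x).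
Proof.
move=> Fc; apply: (@continuous_big R^o I +%R 0 xpredT) => //.
exact: add_continuous.
Qed.

Lemma continuous_mulmx m n p q (A : 'M[R]_(m, n)) (B : 'M[R]_(p, q)) :
  continuous (fun X : 'M[R]_(n, p) => A *m X *m B).
Proof.
apply: continuous_mx => i j; under eq_fun do rewrite mxE.
apply: continuous_bigsum => k.
have h : continuous (fun X : 'M[R]_(n, p) => (A *m X) i k).
  under eq_fun do rewrite mxE.
  apply: continuous_bigsum => l x.
  apply: continuousM; first exact: cst_continuous.
  exact: coord_continuous.
by move=> x; apply: continuousM; [exact: h|exact: cst_continuous].
Qed.

(** Heine--Borel, carried over from row vectors: [S] is a closed subset of the image of a compact
    box under [vec_mx]. *)
Lemma compact_mx m n (S : set 'M[R]_(m, n)) (c : R) :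
  closed S -> (forall X, S X -> forall i j, `|X i j| <= c) -> compact S.
Proof.
move=> Scl Sb.
have vc : continuous (@vec_mx R m n).
  apply: continuous_mx => i j; under eq_fun do rewrite mxE.
  exact: coord_continuous.
have boxc : compact [set v : 'rV[R]_(m * n) |
    forall i, `[- c, c]%classic (v ord0 i)].
  by apply: (@rV_compact R _ (fun=> `[- c, c]%classic)) => _;
    exact: segment_compact.
apply: subclosed_compact Scl
  (continuous_compact (continuous_subspaceT vc) boxc) _ => X SX.
exists (mxvec X); last exact: mxvecK.
move=> l; rewrite /= in_itv/= -ler_norml.
case/mxvec_indexP: l => i j; rewrite mxvecE; exact: Sb.
Qed.

Lemma mx_exists_min m n (S : set 'M[R]_(m, n)) (h : 'M[R]_(m, n) -> R) c :
  closed S -> (forall X, S X -> forall i j, `|X i j| <= c) -> S !=set0 ->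
  continuous h -> exists2 X, S X & forall Y, S Y -> h X <= h Y.
Proof.
move=> Scl Sb S0 hc.
have [X XS Xm] := compact_EVT_min S0 (compact_mx Scl Sb)
  (continuous_subspaceT hc).
exists X; first by rewrite inE in XS.
by move=> Y SY; apply: Xm; rewrite inE.
Qed.

End MatrixTopology.

Section MatrixNorms.
Context {R : realType}.

Lemma sqr_enorm n (x : 'cV[R]_n) : enorm x ^+ 2 = (x^T *m x) 0 0.
Proof.
rewrite sqr_sqrtr; last by apply: sumr_ge0 => i _; exact: sqr_ge0.
by rewrite mxE; apply: eq_bigr => i _; rewrite mxE expr2.
Qed.

Lemma enorm_ge0 n (x : 'cV[R]_n) : 0 <= enorm x.
Proof. exact: sqrtr_ge0. Qed.

Lemma enormZ n a (x : 'cV[R]_n) : enorm (a *: x) = `|a| * enorm x.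
Proof.
apply/eqP; rewrite -(@eqrXn2 _ 2)// ?mulr_ge0 ?enorm_ge0// exprMn !sqr_enorm.
rewrite real_normK ?num_real// [(a *: x)^T]linearZ/= -scalemxAl -scalemxAr.
by rewrite scalerA mxE -expr2.
Qed.

Lemma enorm0 n : enorm (0 : 'cV[R]_n) = 0.
Proof. by rewrite -(scale0r 0) enormZ normr0 mul0r. Qed.

Lemma enorm_eq0 n (x : 'cV[R]_n) : (enorm x == 0) = (x == 0).
Proof.
apply/eqP/eqP => [/eqP|->]; last exact: enorm0.
rewrite sqrtr_eq0 => x0; apply/colP => i; rewrite mxE.
have /eqP : \sum_i x i 0 ^+ 2 = 0.
  apply/eqP; rewrite eq_le x0/=; apply: sumr_ge0 => j _; exact: sqr_ge0.
rewrite psumr_eq0; last by move=> j _; exact: sqr_ge0.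
by move=> /allP/(_ i (mem_index_enum _)); rewrite sqrf_eq0 => /eqP.
Qed.

Lemma ler_abs_enorm n (x : 'cV[R]_n) i : `|x i 0| <= enorm x.
Proof.
rewrite -sqrtr_sqr ler_wsqrtr// (bigD1 i)//= lerDl.
by apply: sumr_ge0 => j _; exact: sqr_ge0.
Qed.

Lemma enorm_mulmx_le m n (M : 'M[R]_(m, n)) x :
  enorm (M *m x) <= spectral_norm M * enorm x.
Proof.
(* The [sup] is meaningful only for a bounded set; absolute row sums give a crude bound on the unit
   ball. *)
have ub : has_ubound [set enorm (M *m x) | x in [set x | enorm x <= 1]].
  exists (Num.sqrt (\sum_i (\sum_j `|M i j|) ^+ 2)) => _ [y y1 <-].
  rewrite ler_wsqrtr// ler_sum// => i _.
  rewrite mxE -(real_normK (num_real (\sum_j _))).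
  rewrite ler_pXn2r// ?nnegrE//; last by apply: sumr_ge0.
  apply: le_trans (ler_norm_sum _ _ _) _; apply: ler_sum => j _.
  rewrite normrM -[leRHS]mulr1 ler_wpM2l//.
  exact: le_trans (ler_abs_enorm _ _) y1.
have [->|x0] := eqVneq x 0.
  by rewrite mulmx0 !enorm0 mulr0.
have ex0 : 0 < enorm x by rewrite lt0r enorm_eq0 x0 enorm_ge0.
rewrite -ler_pdivrMr// mulrC.
have -> : (enorm x)^-1 * enorm (M *m x) = enorm (M *m ((enorm x)^-1 *: x)).
  by rewrite -scalemxAr enormZ gtr0_norm// invr_gt0.
apply: ub_le_sup => //; exists ((enorm x)^-1 *: x) => //=.
by rewrite enormZ gtr0_norm ?invr_gt0// mulVf// gt_eqF.
Qed.

Lemma sigma_min_ge0 m n (M : 'M[R]_(m, n)) : 0 <= sigma_min M.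
Proof.
have [[s Ss]|/forallNP S0] := pselect (exists s, singular_value M s /\ s != 0).
  by apply: lb_le_inf; [exists s|move=> ? [[]]].
rewrite /sigma_min (_ : [set s | _] = set0) ?inf0//.
by rewrite -subset0 => s /S0.
Qed.

Lemma sigma_min_le m n (M : 'M[R]_(m, n)) s :
  singular_value M s -> s != 0 -> sigma_min M <= s.
Proof.
move=> Ms s0; apply: ge_inf; last by [].
by exists 0 => ? [[]].
Qed.

(* A minimizer [w] of [x |-> |M^T x|^2] on the unit sphere of the range of [M]
   satisfies [M M^T w = l w], so that [l] is the square of a singular value. *)
Lemma sigma_min_range m n (M : 'M[R]_(m, n)) v :
  sigma_min M ^+ 2 * enorm (M *m v) ^+ 2 <= enorm (M^T *m (M *m v)) ^+ 2.
Proof.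
have [Mv0|Mv0] := eqVneq (M *m v) 0.
  by rewrite Mv0 mulmx0 !enorm0 expr0n mulr0.
(* Describing the range of [M] by the equation [x^T *m N = 0] makes it visibly closed. *)
pose N := cokermx M^T.
have rangeP (x : 'cV[R]_m) : (exists u, x = M *m u) <-> x^T *m N = 0.
  split=> [[u ->]|/eqP].
    by rewrite trmx_mul -mulmxA mulmx_coker mulmx0.
  rewrite -submxE => /submxP[D xD]; exists D^T.
  by rewrite -[LHS]trmxK xD trmx_mul trmxK.
pose q (x : 'cV[R]_m) := enorm (M^T *m x) ^+ 2.
pose S := [set x : 'cV[R]_m | x^T *m N = 0 /\ enorm x ^+ 2 = 1].
have sqc k (g : 'cV[R]_m -> 'cV[R]_k) : continuous g ->
    continuous (fun x => enorm (g x) ^+ 2).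
  move=> gc; under eq_fun do rewrite sqr_enorm mxE.
  apply: continuous_bigsum => i x; under eq_fun do rewrite mxE.
  have gi : (fun y => g y i 0) @ x --> g x i 0.
    exact: (continuous_comp (gc x) (@coord_continuous _ _ _ i 0 _)).
  exact: (continuousM gi gi).
have idc : continuous (fun x : 'cV[R]_m => x) by move=> x.
have Scl : closed S.
  have -> : S = (fun x : 'cV[R]_m => N^T *m x *m 1%:M) @^-1` [set 0] `&`
      (fun x => enorm x ^+ 2) @^-1` [set 1].
    apply/seteqP; split => x /= [h x1]; split=> //.
      by rewrite mulmx1 -[x]trmxK -trmx_mul h trmx0.
    by rewrite -[N]trmxK -trmx_mul -[_ *m x]mulmx1 h trmx0.
  apply: closedI; apply: closed_comp.
  - by move=> x _; exact: continuous_mulmx.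
  - exact/accessible_closed_set1/hausdorff_accessible/norm_hausdorff.
  - by move=> x _; exact: sqc.
  - exact/accessible_closed_set1/hausdorff_accessible/norm_hausdorff.
have Sb x : S x -> forall i j, `|x i j| <= 1.
  move=> [_ xx1] i j.
  have /eqP x1 : enorm x == 1 by rewrite -(@eqrXn2 _ 2) ?enorm_ge0// xx1 expr1n.
  by rewrite ord1 -[leRHS]x1 ler_abs_enorm.
have Snorm x : x^T *m N = 0 -> x != 0 -> S ((enorm x)^-1 *: x).
  move=> xN x0; split.
    by rewrite [(_ *: x)^T]linearZ/= -scalemxAl xN scaler0.
  rewrite enormZ gtr0_norm ?invr_gt0 ?lt0r ?enorm_eq0 ?x0 ?enorm_ge0//.
  by rewrite mulVf ?expr1n ?enorm_eq0.
have MvN : (M *m v)^T *m N = 0 by apply/rangeP; exists v.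
have qc : continuous q.
  apply: sqc.
  rewrite (_ : mulmx M^T = fun x : 'cV[R]_m => M^T *m x *m 1%:M).
    exact: continuous_mulmx.
  by apply/funext => x; rewrite mulmx1.
have [w [wN w1] wmin] := mx_exists_min Scl Sb
  (ex_intro _ _ (Snorm _ MvN Mv0)) qc.
have wS x : x^T *m N = 0 -> q w * enorm x ^+ 2 <= q x.
  have [->|x0 xN] := eqVneq x 0.
    by move=> _; rewrite enorm0 expr0n mulr0 sqr_ge0.
  have := wmin _ (Snorm x xN x0).
  rewrite /q -scalemxAr enormZ exprMn real_normK ?num_real// exprVn mulrC.
  by rewrite ler_pdivlMr// exprn_gt0// lt0r enorm_eq0 x0 enorm_ge0.
(* The residual of the eigenvalue equation lies in the range, so w + t u is admissible in [wS].
   There the first-order term in t is -2 |u|^2, which forces u = 0. *)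
pose u := q w *: w - M *m (M^T *m w).
have uN : u^T *m N = 0.
  have [z wz] := (rangeP w).2 wN.
  by apply/rangeP; exists (q w *: z - M^T *m w); rewrite mulmxBr -scalemxAr -wz.
have entD (X Y : 'M[R]_1) : (X + Y) 0 0 = X 0 0 + Y 0 0 by rewrite mxE.
have entZ c (X : 'M[R]_1) : (c *: X) 0 0 = c * X 0 0 by rewrite mxE.
have u0 : u = 0.
  apply/eqP; rewrite -enorm_eq0 -sqrf_eq0 -oppr_eq0 eq_le.
  rewrite oppr_le0 sqr_ge0/=.
  suff : 0 <= - 2 * enorm u ^+ 2 by lra.
  apply: (@ge0_of_perturb _ _ (q u - q w * enorm u ^+ 2)) => t _ _.
  have wtu : (w + t *: u)^T *m N = 0.
    rewrite [(w + _)^T]linearD/= [(t *: u)^T]linearZ/= mulmxDl wN.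
    by rewrite -scalemxAl uN scaler0 addr0.
  have := wS _ wtu; rewrite -subr_ge0.
  have dots k (a b : 'cV[R]_k) : enorm (a + t *: b) ^+ 2 =
      enorm a ^+ 2 + 2 * t * (b^T *m a) 0 0 + t ^+ 2 * enorm b ^+ 2.
    have ab : (a^T *m b) 0 0 = (b^T *m a) 0 0.
      by rewrite -[a^T *m b]trmxK mxE trmx_mul trmxK.
    rewrite !sqr_enorm [(a + _)^T]linearD/= [(t *: b)^T]linearZ/= mulmxDl.
    rewrite !mulmxDr -!scalemxAl.
    by rewrite -!scalemxAr !(entD, entZ) ab; ring.
  rewrite {1}/q mulmxDr -scalemxAr !dots -!/(q _) w1.
  have -> : ((M^T *m u)^T *m (M^T *m w)) 0 0 =
      q w * (u^T *m w) 0 0 - enorm u ^+ 2.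
    have -> : q w * (u^T *m w) 0 0 = (u^T *m (q w *: w)) 0 0.
      by rewrite -scalemxAr entZ.
    have -> : q w *: w = u + M *m (M^T *m w) by rewrite subrK.
    rewrite [u^T *m (u + _)]mulmxDr entD -sqr_enorm trmx_mul trmxK -mulmxA.
    by ring.
  congr (0 <= _); ring.
have Mw : M *m (M^T *m w) = q w *: w.
  by apply/eqP; rewrite eq_sym -subr_eq0 -/u u0.
have w0 : w != 0.
  by apply/eqP => w0; move: w1; rewrite w0 sqr_enorm mulmx0 mxE => /eqP;
    rewrite eq_sym oner_eq0.
(* The eigenvalue is nonzero: if w = M z and M^T w = 0, then |w|^2 = z^T M^T w = 0. *)
have Mw0 : M^T *m w != 0.
  apply: contraNneq w0 => Mw0; have [z wz] := (rangeP w).2 wN.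
  by rewrite -enorm_eq0 -sqrf_eq0 sqr_enorm {1}wz trmx_mul -mulmxA Mw0 mulmx0
    mxE.
have qw0 : 0 < q w by rewrite exprn_gt0// lt0r enorm_eq0 Mw0 enorm_ge0.
have sv : singular_value M (Num.sqrt (q w)).
  split; first exact: sqrtr_ge0.
  rewrite sqr_sqrtr ?ltW//; apply/eigenvalueP; exists (M^T *m w)^T.
    have -> : M^T *m M = (M^T *m M)^T by rewrite trmx_mul trmxK.
    by rewrite -trmx_mul -mulmxA Mw -scalemxAr linearZ.
  by rewrite -(inj_eq trmx_inj) trmxK trmx0.
apply: le_trans (wS _ MvN); apply: ler_wpM2r; first exact: sqr_ge0.
rewrite -[leRHS](sqr_sqrtr (ltW qw0)) ler_pXn2r// ?nnegrE ?sqrtr_ge0//.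
  by apply: sigma_min_le => //; rewrite gt_eqF// sqrtr_gt0.
exact: sigma_min_ge0.
Qed.

(** If M^T M C = 0 then (M C)^T (M C) = 0, so M C = 0; hence the row space of M lies in that of M^T
    M. *)
Lemma normal_equations_mx m n (M : 'M[R]_(m, n)) :
  exists G : 'M[R]_(n, m), M^T *m M *m G = M^T.
Proof.
have sq0 p q (X : 'M[R]_(p, q)) : X^T *m X = 0 -> X = 0.
  move=> X0; apply/matrixP => i j; rewrite [RHS]mxE.
  have : enorm (col j X) ^+ 2 = 0.
    rewrite sqr_enorm !colE trmx_mul mulmxA -(mulmxA _ X^T) X0.
    by rewrite mulmx0 mul0mx mxE.
  move=> /eqP; rewrite sqrf_eq0 enorm_eq0 => /eqP/colP/(_ i).
  by rewrite !mxE.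
have : (M <= M^T *m M)%MS.
  rewrite submxE; apply/eqP/sq0.
  by rewrite trmx_mul mulmxA -(mulmxA _ M^T) -mulmxA mulmx_coker mulmx0.
move=> /submxP[D MD]; exists D^T.
by rewrite [in RHS]MD !trmx_mul trmxK.
Qed.

Lemma moore_penrose_unique m n (M : 'M[R]_(m, n)) (P Q : 'M[R]_(n, m)) :
  moore_penrose M P -> moore_penrose M Q -> P = Q.
Proof.
move=> [P1 P2 P3 P4] [Q1 Q2 Q3 Q4].
have MPQ : M *m P = M *m Q.
  transitivity (M *m P *m (M *m Q))^T.
    by rewrite trmx_mul P3 Q3 mulmxA Q1.
  by rewrite mulmxA P1.
have PQM : P *m M = Q *m M.
  transitivity (Q *m M *m (P *m M))^T.
    by rewrite trmx_mul P4 Q4 -mulmxA (mulmxA M) Q1.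
  by rewrite -mulmxA (mulmxA M) P1.
by rewrite -P2 PQM -mulmxA MPQ mulmxA Q2.
Qed.

End MatrixNorms.

(** * Norm bounds and pseudoinverses for tensors *)

Section TensorNorms.
Context {R : realType}.

Lemma tdot_unfold n1 n2 n3 (A B : tensor R n1 n2 n3) :
  tdot A B = \tr ((unfold A)^T *m unfold B).
Proof. by rewrite tr_mxcol mul_mxrow_mxcol linear_sum tdotE. Qed.

Lemma tdot_unfold_col n1 n2 n3 (A : tensor R n1 n2 n3) :
  tdot A A = \sum_j enorm (col j (unfold A)) ^+ 2.
Proof.
rewrite tdot_unfold; apply: eq_bigr => j _.
by rewrite sqr_enorm !mxE; apply: eq_bigr => i _; rewrite !mxE.
Qed.

Section Operator.
Variables (n1 n2 m n3 : nat) (A : tensor R n1 n2 n3.+1).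

(** [bcirc A] acts on each column of [unfold X] separately, and squared Frobenius norms add over
    columns. *)
Lemma tdot_tprod_le (X : tensor R n2 m n3.+1) :
  tdot (tprod A X) (tprod A X) <= tnorm2 A ^+ 2 * tdot X X.
Proof.
rewrite !tdot_unfold_col mulr_sumr; apply: ler_sum => j _.
rewrite unfold_tprod colE -mulmxA -colE -exprMn.
rewrite ler_pXn2r// ?nnegrE ?enorm_ge0//; first exact: enorm_mulmx_le.
exact: le_trans (enorm_ge0 _) (enorm_mulmx_le _ _).
Qed.

(* With s the norm, expand [0 <= |s^2 Y - A A^T Y|^2]. *)
Lemma tdot_ttr_tprod_le (Y : tensor R n1 m n3.+1) :
  tdot (tprod (ttr A) Y) (tprod (ttr A) Y) <= tnorm2 A ^+ 2 * tdot Y Y.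
Proof.
set V := tprod (ttr A) Y; set s := tnorm2 A.
have YV : tdot Y (tprod A V) = tdot V V.
  by rewrite tdotC tdot_tprodl.
have hV := tdot_tprod_le V; rewrite -/s in hV.
have [s0|s0] := eqVneq s 0.
  have AV0 : tdot (tprod A V) (tprod A V) = 0.
    by apply/eqP; rewrite eq_le tdot_ge0 (le_trans hV)// s0 expr0n mul0r.
  move/eqP: AV0; rewrite tdot_eq0 => /eqP AV0.
  by rewrite -YV AV0 tdot0r mulr_ge0 ?sqr_ge0 ?tdot_ge0.
have s2 : 0 < s ^+ 2 by rewrite exprn_even_gt0.
have := tdot_ge0 (s ^+ 2 *: Y - tprod A V).
have -> : tdot (s ^+ 2 *: Y - tprod A V) (s ^+ 2 *: Y - tprod A V) =
    s ^+ 2 * (s ^+ 2 * tdot Y Y) - 2 * (s ^+ 2 * tdot V V) +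
    tdot (tprod A V) (tprod A V).
  by rewrite !tdot_lin (tdotC _ Y) YV; ring.
move=> h; rewrite -(ler_pM2l s2); lra.
Qed.

Lemma sigma_min_tprod (X : tensor R n2 m n3.+1) :
  sigma_min (bcirc A) ^+ 2 * tdot (tprod A X) (tprod A X) <=
  tdot (tprod (ttr A) (tprod A X)) (tprod (ttr A) (tprod A X)).
Proof.
rewrite !tdot_unfold_col mulr_sumr; apply: ler_sum => j _.
rewrite !unfold_tprod bcirc_ttr !colE -!mulmxA.
exact: sigma_min_range.
Qed.

End Operator.

(** The matrix solution [G] need not be block circulant, but folding its first block column is
    enough. *)
Lemma normal_equations n1 n2 n3 (A : tensor R n1 n2 n3.+1) :
  exists X : tensor R n2 n1 n3.+1, tprod (ttr A) (tprod A X) = ttr A.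
Proof.
have [G GA] := normal_equations_mx (bcirc A).
exists (fold (G *m unfold (tdiag n3 1%:M))).
rewrite -[RHS]tprod1r; congr fold.
by rewrite unfold_tprod foldK !mulmxA bcirc_ttr GA.
Qed.

(* If X and Y solve the normal equations of A and of its transpose, then
   Y^T A X is the Moore--Penrose inverse. *)
Lemma bcirc_tpinv n1 n2 n3 (A : tensor R n1 n2 n3.+1) :
  moore_penrose (bcirc A) (bcirc (tpinv A)).
Proof.
have [X /(congr1 (@bcirc _ _ _ _))] := normal_equations A.
have [Y /(congr1 (@bcirc _ _ _ _))] := normal_equations (ttr A).
rewrite ttrK !bcirc_tprod !bcirc_ttr.
set M := bcirc A; set P := bcirc X => hQ hP.
pose Q := (bcirc Y)^T.
have hQ' : Q *m (M *m M^T) = M^T.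
  by have := congr1 trmx hQ; rewrite !trmx_mul !trmxK mulmxA.
have MP : P^T *m M^T *m M = M.
  by have := congr1 trmx hP; rewrite !trmx_mul !trmxK.
have MPs : (M *m P)^T = M *m P.
  by rewrite -{2}MP -!mulmxA hP trmx_mul.
have MPM : M *m P *m M = M by rewrite -MPs trmx_mul MP.
have QMs : (Q *m M)^T = Q *m M.
  by rewrite trmx_mul trmxK -[in RHS]hQ (mulmxA M) (mulmxA Q) hQ'.
have MQM : M *m (Q *m M) = M.
  by rewrite -QMs trmx_mul trmxK hQ.
have mp : moore_penrose M (Q *m M *m P).
  have e1 : M *m (Q *m M *m P) = M *m P by rewrite mulmxA MQM.
  have e2 : Q *m M *m P *m M = Q *m M by rewrite -!mulmxA (mulmxA M) MPM.
  by split; rewrite ?e1 ?e2// mulmxA -(mulmxA Q M) MQM.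
(* The Moore--Penrose inverse just built is the [bcirc] of a tensor, so the choices defining [mpinv]
   and [tpinv] are both made from nonempty sets. *)
have bP : bcirc (tprod (tprod (ttr Y) A) X) = mpinv M.
  rewrite !bcirc_tprod bcirc_ttr; apply: (moore_penrose_unique mp).
  by apply: (@xgetPex _ 0 [set P | moore_penrose M P]); exists (Q *m M *m P).
have -> : bcirc (tpinv A) = mpinv M.
  by apply: (@xgetPex _ 0 [set P | bcirc P = mpinv (bcirc A)]);
    exists (tprod (tprod (ttr Y) A) X).
by rewrite -bP !bcirc_tprod bcirc_ttr.
Qed.

(** As M M^+ is symmetric, M^T M M^+ is the transpose of M M^+ M = M. This makes B minus its
    projection orthogonal to the range of A. *)
Lemma ttr_tprod_tpinv n1 n2 m n3 (A : tensor R n1 n2 n3.+1)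
    (B : tensor R n1 m n3.+1) :
  tprod (ttr A) (tprod (tprod A (tpinv A)) B) = tprod (ttr A) B.
Proof.
have [h _ hs _] := bcirc_tpinv A.
rewrite tprodA; congr tprod; apply: bcirc_inj.
by rewrite !bcirc_tprod bcirc_ttr -hs -trmx_mul h.
Qed.

End TensorNorms.

(** * Conjugates of strongly convex functions *)

Section TensorTopology.
Context {R : realType} {n1 n2 n3 : nat}.
Local Notation T := (tensor R n1 n2 n3).

Lemma continuous_tdot (Z : T) : continuous (tdot Z).
Proof.
do 3!apply: continuous_bigsum => ?.
under eq_fun do rewrite [X in _ * X]frontalE.
move=> X.
by apply: continuousM; [exact: cst_continuous|exact: coord_continuous].
Qed.

Lemma continuous_tdot_sqr : continuous (fun X : T => tdot X X).
Proof.
do 3!apply: continuous_bigsum => ?.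
under eq_fun do rewrite frontalE.
by move=> X; apply: continuousM; exact: coord_continuous.
Qed.

Lemma sqr_coord_le_tdot (X : T) k l : X k l ^+ 2 <= tdot X X.
Proof.
case/mxvec_indexP: l => i j; rewrite -frontalE.
rewrite /tdot (bigD1 k)//= (bigD1 i)//= (bigD1 j)//= -expr2 -!addrA lerDl.
by rewrite !addr_ge0//; do ?[apply: sumr_ge0 => ? _]; exact: sqr_ge0.
Qed.

(** Differentiability refers to the entrywise maximum norm, the estimates on the conjugate to the
    Frobenius norm; this links the two. *)
Lemma tdot_le_mx_norm : exists2 c : R, 0 < c &
  forall X : T, tdot X X <= c * `|X| ^+ 2.
Proof.
exists ((n2 * n1 * n3)%:R + 1) => [|X]; first by rewrite ltr_wpDl.
apply: (@le_trans _ _ ((n2 * n1 * n3)%:R * `|X| ^+ 2)).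
  have -> : (n2 * n1 * n3)%:R * `|X| ^+ 2 =
      \sum_(k < n3) \sum_(i < n1) \sum_(j < n2) `|X| ^+ 2.
    by rewrite mulr_natl !mulrnA !sumr_const !card_ord.
  apply: ler_sum => k _; apply: ler_sum => i _; apply: ler_sum => j _.
  rewrite frontalE -expr2.
  rewrite -(real_normK (num_real (X _ _))) ler_pXn2r ?nnegrE//.
  rewrite [leRHS]/Num.norm/= mx_normrE.
  by apply/bigmax_geP; right; exists (k, mxvec_index i j).
by rewrite ler_wpM2r ?sqr_ge0// lerDl.
Qed.

Lemma tdot_add_le (X Y : T) :
  tdot (X + Y) (X + Y) <= 2 * tdot X X + 2 * tdot Y Y.
Proof.
have := tdot_young X Y (@ltr01 R); rewrite !tdot_lin (tdotC Y X); lra.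
Qed.

Lemma tdot_sqrD (X D : T) t : tdot (X + t *: D) (X + t *: D) =
  tdot X X + 2 * t * tdot X D + t ^+ 2 * tdot D D.
Proof. by rewrite !tdot_lin (tdotC D X); ring. Qed.

Lemma tensor_exists_min (S : set T) (h : T -> R) (c : R) :
  closed S -> (forall X, S X -> tdot X X <= c) -> S !=set0 -> continuous h ->
  exists2 X, S X & forall Y, S Y -> h X <= h Y.
Proof.
move=> Scl Sb S0 hc.
apply: (@mx_exists_min _ _ _ S h (c + 1)) => // X SX i j.
have := sqr_coord_le_tdot X i j; have := Sb X SX; have := sqr_ge0 (X i j).
have := normr_ge0 (X i j); rewrite -(real_normK (num_real (X i j))).
set x := `|_|; nra.
Qed.

Lemma tensor_exists_global_min (h : T -> R) X0 (c : R) : continuous h ->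
  (forall X, h X <= h X0 -> tdot X X <= c) ->
  exists X, forall Y, h X <= h Y.
Proof.
move=> hc hb.
have [||//|X hX Xmin] := @tensor_exists_min [set X | h X <= h X0] h c _ hb.
- have -> : [set X | h X <= h X0] = h @^-1` [set x | x <= h X0] by [].
  by apply: closed_comp => [X _|]; [exact: hc|exact: closed_le].
- by exists X0 => /=.
exists X => Y; have [/Xmin//|YX0] := leP (h Y) (h X0).
by apply: le_trans (ltW YX0).
Qed.

End TensorTopology.

Section Conjugate.
Context {R : realType} {n1 n2 n3 : nat}.
Local Notation T := (tensor R n1 n2 n3).
Variables (f : T -> R) (gamma : R).
Hypotheses (gamma_gt0 : 0 < gamma) (f_sc : strongly_convex gamma f).

Let f_continuous : continuous f.
Proof. by case: f_sc. Qed.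

Let f_convex X Y t : 0 <= t -> t <= 1 ->
  f (X + t *: (Y - X)) <= f X + t * (f Y - f X).
Proof.
case: f_sc => cf _ _ t0 t1.
have : f (t *: Y + (1 - t) *: X) <= t * f Y + (1 - t) * f X.
  by apply: (cf (Itv01 t0 t1)); rewrite inE.
have -> : t *: Y + (1 - t) *: X = X + t *: (Y - X).
  by rewrite scalerBr scalerBl scale1r addrCA.
lra.
Qed.

Let f_sc_ineq X Y Z : subdiff f X Z ->
  f X + tdot Z (Y - X) + gamma / 2 * tdot (Y - X) (Y - X) <= f Y.
Proof. by case: f_sc => _ _ h /h; rewrite -tnormF_sqr; apply. Qed.

(* The unit ball controls f from below by an affine function of the norm, so
   f + |.|^2 / 2 has a minimizer X, and -X is a subgradient there. *)
Lemma exists_subgradient : exists X Z, subdiff f X Z.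
Proof.
have [] := @tensor_exists_min R n1 n2 n3 [set X | tdot X X <= 1] f 1.
- have -> : [set X : T | tdot X X <= 1] =
    (fun X : T => tdot X X) @^-1` [set x | x <= 1] by [].
  apply: closed_comp => [X _|]; [exact: continuous_tdot_sqr|exact: closed_le].
- by [].
- by exists 0; rewrite /= tdot0r.
- exact: f_continuous.
move=> Xb _ Xb_min; set b := f Xb in Xb_min.
have b0 : b <= f 0 by apply: Xb_min; rewrite /= tdot0r.
pose h X := f X + 2^-1 * tdot X X.
have hc : continuous h.
  move=> X; apply: (@continuousD R R^o T f); first exact: f_continuous.
  by apply: continuousM; [exact: cst_continuous|exact: continuous_tdot_sqr].
have [|X hX] := @tensor_exists_global_min R n1 n2 n3 h 0
  (1 + (2 * (f 0 - b)) ^+ 2) hc.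
  move=> X; rewrite /h tdot0r mulr0 addr0 => hX.
  have [|X1] := leP (tdot X X) 1; first by have := sqr_ge0 (2 * (f 0 - b)); lra.
  pose r := tnormF X; have rX : r ^+ 2 = tdot X X by exact: tnormF_sqr.
  have r1 : 1 < r.
    by have := tnormF_ge0 X; rewrite -/r; rewrite -rX in X1; nra.
  have r0 : 0 < r by lra.
  (* The point X / r of the unit ball lies on the segment from 0 to X, so convexity gives f X >= f 0
     - r (f 0 - b); with h X <= h 0 this yields r <= 2 (f 0 - b). *)
  have := @f_convex 0 X r^-1; rewrite invr_ge0 ltW// invf_le1// ltW//.
  move=> /(_ isT isT); rewrite add0r subr0.
  have : b <= f (r^-1 *: X).
    apply: Xb_min => /=; rewrite !tdot_lin -rX.
    by rewrite [leLHS](_ : _ = 1)//; field; rewrite gt_eqF.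
  move=> b1 /(le_trans b1) /(ler_wpM2l (ltW r0)).
  rewrite mulrDr mulrA divff ?gt_eqF// mul1r => b2.
  have rb : r <= 2 * (f 0 - b) by rewrite -rX in hX; nra.
  by rewrite -rX; nra.
exists X, (- X) => Y; rewrite tdotNl.
suff : 0 <= f Y - f X + tdot X (Y - X) by lra.
apply: (@ge0_of_perturb _ _ (2^-1 * tdot (Y - X) (Y - X))) => t t0 t1.
have := hX (X + t *: (Y - X)); rewrite /h.
have := f_convex X Y (ltW t0) t1.
rewrite tdot_sqrD; lra.
Qed.

(** Strong convexity is stated through subgradients, so one must be known before it can be used;
    from it, f - <Z, .> is coercive, and Z is a subgradient of f at its minimizer. *)
Lemma exists_subdiff Z : exists X, subdiff f X Z.
Proof.
have [X0 [Z0 Z0X0]] := exists_subgradient.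
pose h X := f X - tdot Z X.
have hc : continuous h.
  move=> X; apply: (@continuousB R R^o T f); first exact: f_continuous.
  exact: continuous_tdot.
have [|X hX] := @tensor_exists_global_min R n1 n2 n3 h X0
  (2 * (4 / gamma ^+ 2 * tdot (Z - Z0) (Z - Z0)) + 2 * tdot X0 X0) hc.
  move=> X hX; have := f_sc_ineq X Z0X0.
  (* Young's inequality with weight gamma / 2 absorbs half of the strong convexity term, leaving
     gamma / 4 |X - X0|^2 <= |Z - Z0|^2 / gamma. *)
  have g2 : 0 < gamma / 2 by rewrite divr_gt0.
  have := tdot_young (X - X0) (Z - Z0) g2.
  rewrite (tdotC _ (Z - Z0)) tdotBl.
  have := tdot_add_le (X - X0) X0; rewrite subrK.
  move: hX; rewrite /h.
  have -> : tdot Z X = tdot Z (X - X0) + tdot Z X0 by rewrite tdotBr; ring.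
  have -> : 4 / gamma ^+ 2 * tdot (Z - Z0) (Z - Z0) =
      4 / gamma * ((2 * (gamma / 2))^-1 * tdot (Z - Z0) (Z - Z0)).
    by field; rewrite gt_eqF.
  set u := tdot (X - X0) (X - X0); set q := (2 * _)^-1 * _ => h1 h2 h3 h4.
  have h5 : gamma / 4 * u <= q by lra.
  have : u <= 4 / gamma * q.
    have := ler_wpM2l (ltW (divr_gt0 (ltr0n R 4) gamma_gt0)) h5.
    by rewrite [X in X <= _](_ : _ = u)//; field; rewrite gt_eqF.
  lra.
exists X => Y; have := hX Y; rewrite /h tdotBr; lra.
Qed.

Lemma conjugateE X Z : subdiff f X Z -> conjugate f Z = tdot Z X - f X.
Proof.
move=> ZX; apply/eqP; rewrite eq_le; apply/andP; split.
  apply: sup_le_ub; first by exists (tdot Z X - f X); exists X.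
  by move=> _ [Y _ <-]; have := ZX Y; rewrite tdotBr; lra.
apply: ub_le_sup; last by exists X.
exists (tdot Z X - f X) => _ [Y _ <-].
by have := ZX Y; rewrite tdotBr; lra.
Qed.

Lemma conjugate_ge X Z H : subdiff f X Z ->
  conjugate f Z + tdot H X <= conjugate f (Z + H).
Proof.
move=> ZX; have [Y HY] := exists_subdiff (Z + H).
rewrite (conjugateE ZX) (conjugateE HY).
have := HY X; rewrite tdotBr !(tdotDl Z H); lra.
Qed.

(** Smoothness of the conjugate: the gain gamma / 2 |Y - X|^2 from strong convexity absorbs <H, Y -
    X> up to |H|^2 / (2 gamma). *)
Lemma conjugate_le X Z H : subdiff f X Z ->
  conjugate f (Z + H) <=
    conjugate f Z + tdot H X + (2 * gamma)^-1 * tdot H H.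
Proof.
move=> ZX; have [Y HY] := exists_subdiff (Z + H).
rewrite (conjugateE ZX) (conjugateE HY).
have := f_sc_ineq Y ZX; have := tdot_young (Y - X) H gamma_gt0.
rewrite (tdotC _ H) (tdotDl Z H) (tdotBr H) (tdotBr Z).
set u := tdot (_ - _) _; set v := _^-1 * tdot H H; lra.
Qed.

Lemma conjugate_expansion X Z (e : R) : subdiff f X Z -> 0 < e ->
  \forall H \near (0 : T),
    `|conjugate f (H + Z) - (conjugate f Z + tdot X H)| <= e * `|H|.
Proof.
move=> ZX e0; have [c c0 normc] := @tdot_le_mx_norm R n1 n2 n3.
(* Within this radius the quadratic error c |H|^2 / (2 gamma) is at most e |H|. *)
have d0 : 0 < 2 * gamma * e / c by rewrite divr_gt0// !mulr_gt0.
apply: filterS (@nbhs0_le R T _ d0) => H; have := normc H.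
have := normr_ge0 H; set h := `|H| => h0 normH Hd.
rewrite (addrC H) (tdotC X).
have := conjugate_ge H ZX; have := conjugate_le H ZX.
rewrite -lerBlDl => up low; rewrite ger0_norm ?subr_ge0//.
apply: (le_trans up).
apply: (@le_trans _ _ ((2 * gamma)^-1 * (c * h ^+ 2))).
  by rewrite ler_wpM2l// invr_ge0 mulr_ge0// ltW.
rewrite expr2 !mulrA ler_wpM2r//.
apply: le_trans (ler_wpM2l _ Hd) _.
  by rewrite mulr_ge0 ?invr_ge0 ?mulr_ge0// ltW.
rewrite le_eqVlt; apply/orP; left; apply/eqP; field.
by rewrite !gt_eqF.
Qed.

Lemma tdot_scalable (X : T) : scalable (tdot X : T -> R^o).
Proof. by move=> a Y; exact: tdotZr. Qed.

Lemma gradient_conjugate X Z : subdiff f X Z -> gradient (conjugate f) Z = X.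
Proof.
move=> ZX.
pose L : {linear T -> R^o} := HB.pack (tdot X : T -> R^o)
  (GRing.isZmodMorphism.Build _ _ (tdot X : T -> R^o) (tdotBr X))
  (GRing.isScalable.Build _ _ _ _ (tdot X : T -> R^o) (tdot_scalable X)).
have expansion : (conjugate f : T -> R^o) \o shift Z =
    cst (conjugate f Z : R^o) + L +o_ 0 id.
  by apply/eqaddoP => e e0; exact: conjugate_expansion ZX e0.
have Lc : continuous L by exact: continuous_tdot.
have dL : 'd (conjugate f : T -> R^o) Z = L :> (T -> R^o).
  exact: diff_unique Lc expansion.
have df : differentiable (conjugate f : T -> R^o) Z.
  by apply/diff_locallyP; rewrite dL.
apply: xget_unique => [|G [_ dG]].
  by split=> // H; rewrite dL.
apply/eqP; rewrite -subr_eq0 -tdot_eq0; apply/eqP.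
by rewrite tdotBl -dG dL subrr.
Qed.

(** From here on, this is the only property of the gradient of the conjugate that is used. *)
Lemma subdiff_gradient_conjugate Z :
  subdiff f (gradient (conjugate f) Z) Z.
Proof.
by have [X ZX] := exists_subdiff Z; rewrite (gradient_conjugate ZX).
Qed.

Local Notation grad := (gradient (conjugate f)).

Lemma bregman_ge Z Y :
  gamma / 2 * tdot (Y - grad Z) (Y - grad Z) <= bregman f Z (grad Z) Y.
Proof.
have := f_sc_ineq Y (subdiff_gradient_conjugate Z); rewrite /bregman; lra.
Qed.

(** For X = grad Z the Bregman distance is f Y - <Z, Y> plus the conjugate at Z, so as a function of
    Z it inherits the smoothness of the conjugate. *)
Lemma bregman_add_le Z H Y :
  bregman f (Z + H) (grad (Z + H)) Y <= bregman f Z (grad Z) Y +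
    tdot H (grad Z - Y) + (2 * gamma)^-1 * tdot H H.
Proof.
have := subdiff_gradient_conjugate Z.
have := subdiff_gradient_conjugate (Z + H).
move: (gradient _ (Z + H)) (gradient _ Z) => X' X hX' hX.
have := conjugate_le H hX; rewrite (conjugateE hX) (conjugateE hX') /bregman.
rewrite !(tdotBr _ Y) (tdotBr _ X) (tdotDl Z H Y); lra.
Qed.

(* First replace the exact direction H by the perturbed H + E, then bound the
   cross term by Young's inequality with weight delta. *)
Lemma bregman_perturb_le (delta : R) Z E Y : 0 < delta ->
  bregman f (Z + E) (grad (Z + E)) Y <=
    (1 + delta / gamma) * bregman f Z (grad Z) Y +
    (delta + gamma) / (2 * delta * gamma) * tdot E E.
Proof.
move=> delta0; apply: le_trans (bregman_add_le Z E Y) _.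
have := bregman_ge Z Y; move: (grad Z) => X.
have := tdot_young (X - Y) E delta0; rewrite (tdotC _ E).
rewrite -(opprB X Y) tdotNl tdotNr opprK; move: (bregman f Z X Y) => D Eh h.
(* Young's term delta / 2 |X - Y|^2 is at most delta / gamma times the Bregman distance; hence the
   factor 1 + delta / gamma. *)
have {h} := ler_wpM2l (ltW (divr_gt0 delta0 gamma_gt0)) h.
have -> : delta / gamma * (gamma / 2 * tdot (X - Y) (X - Y)) =
    delta / 2 * tdot (X - Y) (X - Y).
  by field; rewrite gt_eqF.
have -> : (delta + gamma) / (2 * delta * gamma) =
    (2 * delta)^-1 + (2 * gamma)^-1.
  by field; rewrite !gt_eqF.
move: Eh; set u := tdot (_ - _) _; set v := tdot E E; lra.
Qed.

End Conjugate.

(** * Averages over finitely many independent indices *)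

Section FiniteExpectation.
Context {d : measure_display} {Om : measurableType d} {R : realType}.
Variable P : probability Om R.

(** The integrand is a finite combination of indicators of measurable events, whatever [G] is. *)
Lemma expectation_fin (S : finType) (U : Om -> S) (G : S -> R) :
  (forall s, measurable [set w | U w = s]) ->
  'E_P[fun w => G (U w)]%E =
    (\sum_s fine (P [set w | U w = s]) * G s)%:E.
Proof.
move=> mU; rewrite unlock.
have Pfin s : P [set w | U w = s] \is a fin_num by exact: fin_num_measure.
have int1 s : P.-integrable setT (fun w => (\1_[set w | U w = s] w)%:E).
  by apply: integrable_indic => //; rewrite setTI; exact: mU.
transitivity (\int[P]_w \sum_s ((G s)%:E * (\1_[set w | U w = s] w)%:E))%E.
  apply: eq_integral => w _; rewrite (bigD1 (U w))//= indicE mem_set// mule1.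
  rewrite big1 ?adde0// => s /eqP sU; rewrite indicE memNset ?mule0//=.
  by move=> Us; apply: sU.
rewrite integral_sum//; last by move=> s; exact: integrableZl.
rewrite -sumEFin; apply: eq_bigr => s _; rewrite integralZl//.
by rewrite integral_indic// setIT EFinM fineK// muleC.
Qed.

Lemma expectation_indep (S T : finType) (U : Om -> S) (V : Om -> T)
    (p : T -> R) (G : S -> T -> R) :
  (forall s, measurable [set w | U w = s]) ->
  (forall t, measurable [set w | V w = t]) ->
  (forall s t, P ([set w | U w = s] `&` [set w | V w = t]) =
    (P [set w | U w = s] * (p t)%:E)%E) ->
  'E_P[fun w => G (U w) (V w)]%E =
    (\sum_s fine (P [set w | U w = s]) * \sum_t p t * G s t)%:E.
Proof.
move=> mU mV UV.
have pairE s t : [set w | (U w, V w) = (s, t)] =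
    [set w | U w = s] `&` [set w | V w = t].
  by apply/seteqP; split => w /= [-> ->].
rewrite (expectation_fin (U := fun w => (U w, V w)) (fun st => G st.1 st.2));
  last by case=> s t; rewrite pairE; exact: measurableI.
congr EFin; transitivity (\sum_st
    fine (P [set w | (U w, V w) = (st.1, st.2)]) * G st.1 st.2).
  by apply: eq_bigr => -[].
rewrite -(pair_bigA _ (fun s t => fine (P [set w | (U w, V w) = (s, t)]) *
  G s t))/=.
apply: eq_bigr => s _; rewrite mulr_sumr; apply: eq_bigr => t _.
by rewrite pairE UV fineM ?fin_num_measure// mulrA.
Qed.

End FiniteExpectation.

(** * Histories of the sampled indices *)

Section Sampling.
Context {d : measure_display} {Om : measurableType d} {R : realType}.
Variable P : probability Om R.
Variables (n1 n2 : nat).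
Local Notation J := 'I_n2.+1.
Local Notation I := 'I_n1.+1.
Variables (cidx : nat -> Om -> J) (ridx : nat -> Om -> I).
Variables (p : J -> R) (q : I -> R).
Hypothesis claw : forall k, random_index_with_law P (cidx k) p.
Hypothesis rlaw : forall k, random_index_with_law P (ridx k) q.
Hypothesis indep : mutually_independent P cidx ridx.

(** The iterates take infinite index sequences, so a finite history is padded with [ord0]; a
    functional [determined] by k draws does not see the padding. *)
Definition extend (n k : nat) (h : {ffun 'I_k -> 'I_n.+1}) (l : nat) : 'I_n.+1 :=
  oapp h ord0 (insub l).

Definition update (n k : nat) (j : 'I_n.+1) (c : nat -> 'I_n.+1) (l : nat) :=
  if l == k then j else c l.

Definition history (k : nat) (w : Om) : {ffun 'I_k -> J} * {ffun 'I_k -> I} :=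
  ([ffun l : 'I_k => cidx l w], [ffun l : 'I_k => ridx l w]).

Definition determined (k : nat) (F : (nat -> J) -> (nat -> I) -> R) :=
  forall c c' r r', (forall l, (l < k)%N -> c l = c' l) ->
    (forall l, (l < k)%N -> r l = r' l) -> F c r = F c' r'.

Definition path_mean (k : nat) (F : (nat -> J) -> (nat -> I) -> R) : R :=
  \sum_h fine (P [set w | history k w = h]) * F (extend h.1) (extend h.2).

Lemma extendE n k (h : {ffun 'I_k -> 'I_n.+1}) (l : 'I_k) : extend h l = h l.
Proof. by rewrite /extend valK. Qed.

(** This is the shape of event to which [mutually_independent] applies. *)
Lemma history_set k h : [set w | history k w = h] =
  \bigcap_(l in [set` iota 0 k]) [set w | cidx l w \in [set extend h.1 l]%SET] `&`
  \bigcap_(l in [set` iota 0 k]) [set w | ridx l w \in [set extend h.2 l]%SET].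
Proof.
apply/seteqP; split => w /=.
  move=> <-; split=> l /=; rewrite mem_iota/= add0n => lk;
  by rewrite inE -[l]/(val (Ordinal lk)) extendE ffunE.
case: h => h1 h2 [/= hc hr]; congr pair; apply/ffunP => l; rewrite ffunE.
  have := hc l; rewrite /= mem_iota/= add0n ltn_ord => /(_ isT).
  by rewrite inE extendE => /eqP.
have := hr l; rewrite /= mem_iota/= add0n ltn_ord => /(_ isT).
by rewrite inE extendE => /eqP.
Qed.

Lemma preimage_set1 n (u : Om -> 'I_n) s :
  [set w | u w \in [set s]%SET] = [set w | u w = s].
Proof. by apply/seteqP; split => w /=; rewrite inE => /eqP. Qed.

Lemma measurable_history k h : measurable [set w | history k w = h].
Proof.
have mc l s : measurable [set w | cidx l w \in [set s]%SET].
  by rewrite preimage_set1; have [] := claw l s.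
have mr l s : measurable [set w | ridx l w \in [set s]%SET].
  by rewrite preimage_set1; have [] := rlaw l s.
rewrite history_set; by apply: measurableI; apply: bigcap_measurableType => l _.
Qed.

Lemma history_indep k h (t : J * I) :
  P ([set w | history k w = h] `&` [set w | (cidx k w, ridx k w) = t]) =
  (P [set w | history k w = h] * (p t.1 * q t.2)%:E)%E.
Proof.
case: t => j i /=.
(* [E] and [F] add the draws of index k to the prescribed history, so the joint event is again one
   product event, over k + 1 indices. *)
pose E l := if l == k then [set j]%SET else [set extend h.1 l]%SET.
pose F l := if l == k then [set i]%SET else [set extend h.2 l]%SET.
have bigcap_rcons (X : nat -> set Om) :
    \bigcap_(l in [set` iota 0 k.+1]) X l =
    \bigcap_(l in [set` iota 0 k]) X l `&` X k.
  have iotaP m l : [set` iota 0 m] l <-> (l < m)%N by rewrite /mkset mem_iota.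
  apply/seteqP; split => w h'.
    split; last by apply: h'; apply/iotaP.
    by move=> l /iotaP lk; apply: h'; apply/iotaP; exact: ltnW.
  move=> l /iotaP; rewrite ltnS leq_eqVlt => /orP[/eqP ->|lk].
    by case: h'.
  by case: h' => h' _; apply: h'; apply/iotaP.
have notk l : l \in iota 0 k -> (l == k) = false.
  by rewrite mem_iota/= add0n => /ltn_eqF.
have -> : [set w | history k w = h] `&` [set w | (cidx k w, ridx k w) = (j, i)] =
    \bigcap_(l in [set` iota 0 k.+1]) [set w | cidx l w \in E l] `&`
    \bigcap_(l in [set` iota 0 k.+1]) [set w | ridx l w \in F l].
  rewrite !bigcap_rcons setIACA history_set /E /F eqxx; congr (_ `&` _).
    congr (_ `&` _); apply: eq_bigcapr => l /= lk; by rewrite (notk l lk).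
  apply/seteqP; split => w /=; rewrite !inE; first by case=> -> ->.
  by case=> /eqP -> /eqP ->.
rewrite history_set !indep ?iota_uniq// -addn1 iotaD !big_cat/= !big_seq1 add0n.
rewrite muleACA /E /F eqxx !preimage_set1; congr (_ * _ * _)%E.
- by apply: eq_big_seq => l lk; rewrite (notk l lk).
- by apply: eq_big_seq => l lk; rewrite (notk l lk).
- by have [_ ->] := claw k j; have [_ ->] := rlaw k i; rewrite EFinM.
Qed.

Lemma expectation_path k F : determined k F ->
  'E_P[fun w => F (cidx ^~ w) (ridx ^~ w)]%E = (path_mean k F)%:E.
Proof.
move=> Fk; rewrite -(expectation_fin P
  (fun h => F (extend h.1) (extend h.2)) (@measurable_history k)).
congr expectation; apply/funext => w; apply: Fk => l lk;
by rewrite -[l]/(val (Ordinal lk)) extendE ffunE.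
Qed.

(** The tower property: the inner double sum is the conditional expectation given the first k
    draws. *)
Lemma path_meanS k F : determined k.+1 F ->
  path_mean k.+1 F = path_mean k (fun c r =>
    \sum_j p j * \sum_i q i * F (update k j c) (update k i r)).
Proof.
move=> Fk; apply: EFin_inj; rewrite -(expectation_path Fk).
pose G (h : {ffun 'I_k -> J} * {ffun 'I_k -> I}) (t : J * I) :=
  F (update k t.1 (extend h.1)) (update k t.2 (extend h.2)).
transitivity ('E_P[fun w => G (history k w) (cidx k w, ridx k w)]%E).
  congr expectation; apply/funext => w /=; apply: Fk => l;
  rewrite ltnS /update leq_eqVlt => /orP[/eqP ->|lk]; rewrite ?eqxx//;
  by rewrite ltn_eqF// -[l]/(val (Ordinal lk)) extendE ffunE.
have mV t : measurable [set w | (cidx k w, ridx k w) = t].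
  case: t => j i.
  have -> : [set w | (cidx k w, ridx k w) = (j, i)] =
      [set w | cidx k w = j] `&` [set w | ridx k w = i].
    by apply/seteqP; split => w /= [-> ->].
  by apply: measurableI; [have [] := claw k j|have [] := rlaw k i].
rewrite (expectation_indep G (@measurable_history k) mV (@history_indep k)).
congr EFin; apply: eq_bigr => h _; congr (_ * _).
rewrite -(pair_bigA _ (fun j i => p j * q i * G h (j, i)))/=.
apply: eq_bigr => j _; rewrite mulr_sumr; apply: eq_bigr => i _.
by rewrite mulrA.
Qed.

Lemma path_mean0 F c r : determined 0 F -> path_mean 0 F = F c r.
Proof.
move=> F0; apply: EFin_inj; rewrite -(expectation_path F0).
rewrite (_ : (fun w => _) = cst (F c r)) ?expectation_cst//.
by apply/funext => w; exact: F0.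
Qed.

Lemma path_mean_le k F G : (forall c r, F c r <= G c r) ->
  path_mean k F <= path_mean k G.
Proof.
move=> FG; apply: ler_sum => h _; rewrite ler_wpM2l//.
exact/fine_ge0/measure_ge0.
Qed.

Lemma path_mean_lin k a b F G :
  path_mean k (fun c r => a * F c r + b * G c r) =
  a * path_mean k F + b * path_mean k G.
Proof.
rewrite !mulr_sumr -big_split; apply: eq_bigr => h _ /=.
by rewrite mulrDr !(mulrCA (fine _)).
Qed.

End Sampling.

(** * One step of the iteration *)

Section Slices.
Context {R : realType} {n1 n2 n3 : nat}.
Implicit Types A : tensor R n1 n2 n3.+1.

Lemma lambda_c_ge A j : lslice A j != 0 ->
  tnorm2 (lslice A j) ^+ 2 <= lambda_c A * tdot (lslice A j) (lslice A j).
Proof.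
move=> s0; rewrite -tnormF_sqr -ler_pdivrMr.
  exact: (le_bigmax 0 (fun j => tnorm2 (lslice A j) ^+ 2 /
    tnormF (lslice A j) ^+ 2)).
by rewrite tnormF_sqr lt0r tdot_eq0 s0 tdot_ge0.
Qed.

Lemma lambda_r_ge A i : hslice A i != 0 ->
  tnorm2 (hslice A i) ^+ 2 <= lambda_r A * tdot (hslice A i) (hslice A i).
Proof.
move=> s0; rewrite -tnormF_sqr -ler_pdivrMr.
  exact: (le_bigmax 0 (fun i => tnorm2 (hslice A i) ^+ 2 /
    tnormF (hslice A i) ^+ 2)).
by rewrite tnormF_sqr lt0r tdot_eq0 s0 tdot_ge0.
Qed.

(** Supplies the nonzero test tensors from which rho_c and rho_r are shown nonnegative. *)
Lemma exists_tprod_neq0 m A : A != 0 ->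
  exists U : tensor R n2 m.+1 n3.+1, tprod A U != 0.
Proof.
move=> A0; apply/not_existsP => AU; move/eqP: A0; apply.
apply: frontalP => k; apply/matrixP => i j.
have /negP/negPn/eqP := AU (tdiag n3 (delta_mx j 0)).
move=> /(congr1 (fun T => frontal T k i 0)).
rewrite frontal_tprod_tdiag !frontal0 [LHS]mxE (bigD1 j)//= big1 ?addr0.
  by rewrite [delta_mx _ _ _ _]mxE !eqxx mulr1 => ->; rewrite !mxE.
by move=> l /negPf lj; rewrite [delta_mx _ _ _ _]mxE lj mulr0.
Qed.

End Slices.

Section Steps.
Context {R : realType} {n1 n2 n3 m : nat}.
Variable A : tensor R n1 n2 n3.+1.
Hypotheses (hA_r : forall i, hslice A i != 0) (hA_c : forall j, lslice A j != 0).
Hypothesis A0 : A != 0.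

Let n_gt0 n1' n2' (T : tensor R n1' n2' n3.+1) : T != 0 -> 0 < tdot T T.
Proof. by move=> T0; rewrite lt0r tdot_eq0 T0 tdot_ge0. Qed.

Definition col_step (alpha : R) (Z : tensor R n1 m n3.+1) j :=
  Z - alpha *: tprod (lslice A j)
    ((tnormF (lslice A j) ^+ 2)^-1 *: tprod (ttr (lslice A j)) Z).

(** A column step only sees the product of its argument with the transpose of A, so it leaves V
    untouched. *)
Lemma col_stepB alpha Z V j : tprod (ttr A) V = 0 ->
  col_step alpha Z j - V = col_step alpha (Z - V) j.
Proof.
move=> V0; rewrite /col_step tprodBr ttr_lslice -(hslice_tprod _ V) V0.
by rewrite (hsliceE 0) tprod0r subr0 addrAC.
Qed.

Lemma col_step_range alpha Z j : (exists U, Z = tprod A U) ->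
  exists U, col_step alpha Z j = tprod A U.
Proof.
move=> [U ZU]; rewrite /col_step {1}ZU lsliceE -tprodA -tprodZr -tprodBr.
by eexists.
Qed.

Lemma tdot_col_step_le alpha Z j :
  tdot (col_step alpha Z j) (col_step alpha Z j) <=
  tdot Z Z - (2 * alpha - alpha ^+ 2 * lambda_c A) /
    tnormF (lslice A j) ^+ 2 *
    tdot (hslice (tprod (ttr A) Z) j) (hslice (tprod (ttr A) Z) j).
Proof.
rewrite hslice_tprod -ttr_lslice /col_step.
have := @tdot_tprod_le _ _ _ m _ (lslice A j) (tprod (ttr (lslice A j)) Z).
have := lambda_c_ge (hA_c j); have := n_gt0 (hA_c j).
rewrite tnormF_sqr tprodZr scalerA -scaleNr tdot_sqrD.
set n := tdot (lslice A j) _; set u := tprod (ttr _) Z => n0 hl hu.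
have -> : tdot Z (tprod (lslice A j) u) = tdot u u.
  by rewrite tdotC tdot_tprodl.
have uu := tdot_ge0 u.
have h : tdot (tprod (lslice A j) u) (tprod (lslice A j) u) <=
    lambda_c A * n * tdot u u by exact: le_trans hu (ler_wpM2r uu hl).
have -> : tdot Z Z - (2 * alpha - alpha ^+ 2 * lambda_c A) / n * tdot u u =
  tdot Z Z + 2 * (- (alpha * n^-1)) * tdot u u +
  (- (alpha * n^-1)) ^+ 2 * (lambda_c A * n * tdot u u).
  by field; rewrite gt_eqF.
by rewrite lerD2l ler_wpM2l// sqr_ge0.
Qed.

Lemma sum_law_c : \sum_j tnormF (lslice A j) ^+ 2 / tnormF A ^+ 2 = 1.
Proof.
rewrite -mulr_suml tnormF_sqr (eq_bigr (fun j => tdot (lslice A j) (lslice A j))).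
  by rewrite sum_tdot_lslice divff// gt_eqF// n_gt0.
by move=> j _; rewrite tnormF_sqr.
Qed.

Lemma sum_law_r : \sum_i tnormF (hslice A i) ^+ 2 / tnormF A ^+ 2 = 1.
Proof.
rewrite -mulr_suml tnormF_sqr (eq_bigr (fun j => tdot (hslice A j) (hslice A j))).
  by rewrite sum_tdot_hslice divff// gt_eqF// n_gt0.
by move=> j _; rewrite tnormF_sqr.
Qed.

(** The sampling weights cancel the slice norms in the denominators, so the decreases add up to a
    multiple of |A^T * W|^2. *)
Lemma mean_col_step_le alpha U :
  0 < alpha < 2 / lambda_c A ->
  \sum_j tnormF (lslice A j) ^+ 2 / tnormF A ^+ 2 *
    tdot (col_step alpha (tprod A U) j) (col_step alpha (tprod A U) j) <=
  (1 - (2 * alpha - alpha ^+ 2 * lambda_c A) * sigma_min (bcirc A) ^+ 2 /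
    tnormF A ^+ 2) * tdot (tprod A U) (tprod A U).
Proof.
move=> /andP[a0 al]; set W := tprod A U.
have coef0 : 0 <= 2 * alpha - alpha ^+ 2 * lambda_c A.
  have l0 : 0 <= lambda_c A by exact: bigmax_ge_id.
  (* With the convention 2 / 0 = 0, the stepsize interval would be empty if [lambda_c A] were 0. *)
  have {}l0 : 0 < lambda_c A.
    rewrite lt0r l0 andbT; apply/eqP => l1.
    by move: al; rewrite l1 invr0 mulr0; lra.
  by move: al; rewrite ltr_pdivlMr//; nra.
set c := _ - _ in coef0 *.
have N0 : 0 < tnormF A ^+ 2 by rewrite tnormF_sqr n_gt0.
apply: (@le_trans _ _ (\sum_j tnormF (lslice A j) ^+ 2 / tnormF A ^+ 2 *
  (tdot W W) - \sum_j c / tnormF A ^+ 2 *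
    tdot (hslice (tprod (ttr A) W) j) (hslice (tprod (ttr A) W) j))).
  rewrite -sumrB; apply: ler_sum => j _.
  have nj : 0 < tnormF (lslice A j) ^+ 2 by rewrite tnormF_sqr n_gt0.
  apply: le_trans (ler_wpM2l _ (tdot_col_step_le _ _ _)) _.
    by rewrite divr_ge0// ltW.
  rewrite -/c mulrBr lerD2l lerN2 le_eqVlt; apply/orP; left; apply/eqP.
  move: (tnormF (lslice A j) ^+ 2) (tnormF A ^+ 2) nj N0 => n N nj N0.
  by field; rewrite !gt_eqF.
rewrite -mulr_suml sum_law_c mul1r -mulr_sumr sum_tdot_hslice.
have := ler_wpM2l (divr_ge0 coef0 (ltW N0)) (sigma_min_tprod A U).
rewrite -/W; set x := tdot (tprod _ _) _; set y := tdot W W.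
have -> : (1 - c * sigma_min (bcirc A) ^+ 2 / tnormF A ^+ 2) * y =
  y - c / tnormF A ^+ 2 * (sigma_min (bcirc A) ^+ 2 * y) by ring.
by rewrite lerD2l lerN2.
Qed.

Section RowStep.
Variables (f : tensor R n2 m n3.+1 -> R) (gamma : R).
Hypotheses (gamma_gt0 : 0 < gamma) (f_sc : strongly_convex gamma f).
Variable Xhat : tensor R n2 m n3.+1.
Local Notation grad := (gradient (conjugate f)).
Local Notation D Y := (bregman f Y (grad Y) Xhat).

Definition row_step (alpha : R) (Y : tensor R n2 m n3.+1)
    (V : tensor R n1 m n3.+1) i :=
  Y - alpha *: tprod (ttr (hslice A i))
    ((tnormF (hslice A i) ^+ 2)^-1 *: hslice V i).

Lemma row_step_range alpha Y V i : range_tr A Y ->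
  range_tr A (row_step alpha Y V i).
Proof.
move=> [U _ <-]; rewrite /row_step hsliceE ttr_tprod -tprodA -tprodZr -tprodBr.
by eexists.
Qed.

Lemma row_stepD alpha Y V W i :
  row_step alpha Y (V + W) i = row_step alpha Y V i +
    (- alpha) *: tprod (ttr (hslice A i))
      ((tnormF (hslice A i) ^+ 2)^-1 *: hslice W i).
Proof.
rewrite /row_step scaleNr -addrA -opprD -scalerDr -tprodDr -scalerDr.
by rewrite !(hsliceE _ i) tprodDr.
Qed.

Lemma tdot_row_dir_le alpha (V : tensor R n1 m n3.+1) i H :
  H = (- alpha) *: tprod (ttr (hslice A i))
    ((tnormF (hslice A i) ^+ 2)^-1 *: hslice V i) ->
  tdot H H <= alpha ^+ 2 * lambda_r A / tnormF (hslice A i) ^+ 2 *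
    tdot (hslice V i) (hslice V i).
Proof.
move=> ->; have := tdot_ttr_tprod_le (hslice A i) (hslice V i).
have := lambda_r_ge (hA_r i); have := n_gt0 (hA_r i).
rewrite tnormF_sqr tprodZr scalerA tdotZl tdotZr.
set n := tdot (hslice A i) _; set v := hslice V i => n0 hl hv.
have h := le_trans hv (ler_wpM2r (tdot_ge0 v) hl).
have -> : alpha ^+ 2 * lambda_r A / n * tdot v v =
  (- alpha / n) ^+ 2 * (lambda_r A * n * tdot v v) by field; rewrite gt_eqF.
by rewrite mulrA -expr2 ler_wpM2l// sqr_ge0.
Qed.

Lemma bregman_row_step_le alpha Y V i : V = tprod A (grad Y - Xhat) ->
  D (row_step alpha Y V i) <= D Y -
    (2 * gamma * alpha - alpha ^+ 2 * lambda_r A) /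
      (2 * gamma * tnormF (hslice A i) ^+ 2) * tdot (hslice V i) (hslice V i).
Proof.
move=> VY; rewrite /row_step -scaleNr.
apply: le_trans (bregman_add_le gamma_gt0 f_sc _ _ _) _.
set H := - alpha *: _; have HH := tdot_row_dir_le (erefl H).
have n0 : 0 < tnormF (hslice A i) ^+ 2 by rewrite tnormF_sqr n_gt0.
(* By adjointness the cross term pairs the slice of V with itself, which makes it a pure
   decrease. *)
have -> : tdot H (grad Y - Xhat) =
    - (alpha / tnormF (hslice A i) ^+ 2 * tdot (hslice V i) (hslice V i)).
  rewrite /H tprodZr scalerA tdotZl tdotC -{2}(ttrK (hslice A i)).
  rewrite -tdot_tprodl ttrK -hslice_tprod -VY; ring.
set v := tdot (hslice V i) _ in HH *.
rewrite -addrA lerD2l.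
have g2 : 0 <= (2 * gamma)^-1 by rewrite invr_ge0 mulr_ge0// ltW.
apply: le_trans (lerD (lexx _) (ler_wpM2l g2 HH)) _.
rewrite le_eqVlt; apply/orP; left; apply/eqP.
move: (tnormF (hslice A i) ^+ 2) n0 => n n0.
by field; rewrite !gt_eqF.
Qed.

Variables (alpha nu : R).
Hypotheses (nu_gt0 : 0 < nu)
  (h_alpha : 0 < alpha < 2 * gamma / lambda_r A).
Hypothesis hnu : forall X Z, subdiff f X Z -> range_tr A Z ->
  bregman f Z X Xhat <= nu^-1 * tnormF (tprod A (X - Xhat)) ^+ 2.

Local Notation rho_r := (1 - (2 * gamma * alpha - alpha ^+ 2 * lambda_r A) * nu
  / (2 * gamma * tnormF A ^+ 2)).

(** The weighted decreases add up to a multiple of |A * (grad Y - Xhat)|^2, which [hnu] bounds below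
    by nu times the Bregman distance; [hnu] applies because Y stays in the range. *)
Lemma mean_exact_row_step_le Y : range_tr A Y ->
  \sum_i tnormF (hslice A i) ^+ 2 / tnormF A ^+ 2 *
    D (row_step alpha Y (tprod A (grad Y - Xhat)) i) <= rho_r * D Y.
Proof.
move=> Yr; set V := tprod A _.
have coef0 : 0 <= 2 * gamma * alpha - alpha ^+ 2 * lambda_r A.
  case/andP: h_alpha => a0 al.
  have l0 : 0 <= lambda_r A by exact: bigmax_ge_id.
  have {}l0 : 0 < lambda_r A.
    rewrite lt0r l0 andbT; apply/eqP => l1.
    by move: al; rewrite l1 invr0 mulr0; lra.
  by move: al; rewrite ltr_pdivlMr//; nra.
set c := _ - _ in coef0 *.
have N0 : 0 < tnormF A ^+ 2 by rewrite tnormF_sqr n_gt0.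
apply: (@le_trans _ _ (\sum_i tnormF (hslice A i) ^+ 2 / tnormF A ^+ 2 * D Y -
  \sum_i c / (2 * gamma * tnormF A ^+ 2) * tdot (hslice V i) (hslice V i))).
  rewrite -sumrB; apply: ler_sum => i _.
  have ni : 0 < tnormF (hslice A i) ^+ 2 by rewrite tnormF_sqr n_gt0.
  apply: le_trans (ler_wpM2l _ (bregman_row_step_le _ _ (erefl V))) _.
    by rewrite divr_ge0// ltW.
  rewrite -/c mulrBr lerD2l lerN2 le_eqVlt; apply/orP; left; apply/eqP.
  move: (tnormF (hslice A i) ^+ 2) (tnormF A ^+ 2) ni N0 => n N ni N0.
  by field; rewrite !gt_eqF.
rewrite -mulr_suml sum_law_r mul1r -mulr_sumr sum_tdot_hslice -tnormF_sqr.
have := hnu (subdiff_gradient_conjugate gamma_gt0 f_sc Y) Yr; rewrite -/V.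
move: (D Y) (tnormF V ^+ 2) (tnormF A ^+ 2) N0 => dY v N N0 hd.
have c0 : 0 <= c / (2 * gamma * N) * nu.
  by rewrite mulr_ge0 ?divr_ge0 ?mulr_ge0 ?(ltW N0)// ltW.
have := ler_wpM2l c0 hd.
have -> : c / (2 * gamma * N) * nu * (nu^-1 * v) =
  c / (2 * gamma * N) * v by field; rewrite !gt_eqF.
have -> : (1 - c * nu / (2 * gamma * N)) * dY =
  dY - c / (2 * gamma * N) * nu * dY by field; rewrite !gt_eqF.
by rewrite lerD2l lerN2.
Qed.

Lemma mean_row_step_le delta Y W : 0 < delta -> range_tr A Y ->
  \sum_i tnormF (hslice A i) ^+ 2 / tnormF A ^+ 2 *
    D (row_step alpha Y (tprod A (grad Y - Xhat) + W) i) <=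
  (1 + delta / gamma) * rho_r * D Y +
  (delta + gamma) / (2 * delta * gamma) *
    (alpha ^+ 2 * lambda_r A / tnormF A ^+ 2) * tdot W W.
Proof.
move=> delta0 Yr; set V := tprod A _.
have N0 : 0 < tnormF A ^+ 2 by rewrite tnormF_sqr n_gt0.
set kap := (delta + gamma) / _.
have kap0 : 0 <= kap by rewrite divr_ge0 ?addr_ge0 ?mulr_ge0// ltW.
have d0 : 0 <= 1 + delta / gamma by rewrite addr_ge0 ?divr_ge0// ltW.
apply: (@le_trans _ _ (\sum_i ((1 + delta / gamma) *
   (tnormF (hslice A i) ^+ 2 / tnormF A ^+ 2 * D (row_step alpha Y V i)) +
   kap * (alpha ^+ 2 * lambda_r A / tnormF A ^+ 2) *
     tdot (hslice W i) (hslice W i)))).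
  apply: ler_sum => i _.
  have ni : 0 < tnormF (hslice A i) ^+ 2 by rewrite tnormF_sqr n_gt0.
  rewrite row_stepD.
  apply: le_trans (ler_wpM2l _ (bregman_perturb_le gamma_gt0 f_sc _ _ _ delta0)) _.
    by rewrite divr_ge0// ltW.
  set H := - alpha *: _; have HH := tdot_row_dir_le (erefl H).
  rewrite mulrDr (mulrCA _ (1 + _)) lerD2l -/kap (mulrCA _ kap) -mulrA.
  rewrite ler_wpM2l//.
  apply: le_trans (ler_wpM2l _ HH) _; first by rewrite divr_ge0// ltW.
  rewrite le_eqVlt; apply/orP; left; apply/eqP.
  move: (tnormF (hslice A i) ^+ 2) (tnormF A ^+ 2) ni N0 => n N ni N0.
  by field; rewrite !gt_eqF.
rewrite big_split/= -!mulr_sumr sum_tdot_hslice lerD2r -mulrA ler_wpM2l//.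
exact: mean_exact_row_step_le.
Qed.

(* If the Bregman distance vanished on the whole range, every element of that
   range would be a subgradient of f at Xhat. *)
Lemma rho_r_ge0 (U : tensor R n1 m n3.+1) : tprod (ttr A) U != 0 -> 0 <= rho_r.
Proof.
move=> U0; rewrite leNgt; apply/negP => rho0.
have sub Y : range_tr A Y -> subdiff f Xhat Y.
  (* With rho_r < 0, this forces D Y <= 0, hence grad Y = Xhat by strong convexity. *)
  move=> Yr; have : 0 <= rho_r * D Y.
    apply: le_trans (mean_exact_row_step_le Yr); apply: sumr_ge0 => i _.
    apply: mulr_ge0; first by apply: divr_ge0; exact: sqr_ge0.
    apply: le_trans (bregman_ge gamma_gt0 f_sc _ _).
    by rewrite mulr_ge0 ?tdot_ge0// divr_ge0// ltW.
  rewrite nmulr_rge0// => D0.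
  have := le_trans (bregman_ge gamma_gt0 f_sc Y Xhat) D0.
  rewrite pmulr_rle0 ?divr_gt0// => h.
  have : Xhat - grad Y == 0 by rewrite -tdot_eq0 eq_le h tdot_ge0.
  rewrite subr_eq0 => /eqP ->.
  exact: subdiff_gradient_conjugate gamma_gt0 f_sc Y.
set V := tprod (ttr A) U in U0; have V0 := n_gt0 U0.
(* Scaled so that the subgradient inequality at Xhat + V fails by exactly 1. *)
pose t := (f (Xhat + V) - f Xhat + 1) / tdot V V.
have /sub/(_ (Xhat + V)) : range_tr A (t *: V).
  by exists (t *: U) => //; rewrite tprodZr.
rewrite addrAC subrr add0r tdotZl /t divfK ?gt_eqF//; lra.
Qed.

End RowStep.

Lemma rho_c_ge0 alpha (U : tensor R n2 m n3.+1) : tprod A U != 0 ->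
  0 < alpha < 2 / lambda_c A ->
  0 <= 1 - (2 * alpha - alpha ^+ 2 * lambda_c A) * sigma_min (bcirc A) ^+ 2 /
    tnormF A ^+ 2.
Proof.
move=> U0 ha; rewrite -(pmulr_lge0 _ (n_gt0 U0)).
apply: le_trans (mean_col_step_le U ha); apply: sumr_ge0 => j _.
by apply: mulr_ge0 (tdot_ge0 _); apply: divr_ge0; exact: sqr_ge0.
Qed.

End Steps.

(** * The iterates *)

Section Iterates.
Context {R : realType} {n1 n2 n3 m : nat}.
Variables (A : tensor R n1 n2 n3.+1) (B : tensor R n1 m n3.+1).
Variables (f : tensor R n2 m n3.+1 -> R) (alpha_c alpha_r : R).
Variable Y0 : tensor R n2 m n3.+1.

Lemma rrekZS k c : rrekZ A B alpha_c c k.+1 =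
  col_step A alpha_c (rrekZ A B alpha_c c k) (c k).
Proof. by []. Qed.

Lemma eq_rrekZ k c c' : (forall l, (l < k)%N -> c l = c' l) ->
  rrekZ A B alpha_c c k = rrekZ A B alpha_c c' k.
Proof.
elim: k => [//|k IH cc]; rewrite 2!rrekZS (cc _ (ltnSn k)) IH.
  by [].
by move=> l lk; apply: cc; exact: ltnW.
Qed.

Lemma rrekYS k c r : rrekY A B f alpha_c alpha_r Y0 c r k.+1 =
  row_step A alpha_r (rrekY A B f alpha_c alpha_r Y0 c r k)
    (tprod A (rrekX A B f alpha_c alpha_r Y0 c r k) - B +
      rrekZ A B alpha_c c k.+1) (r k).
Proof.
rewrite /row_step !(hsliceE _ (r k)) tprodDr tprodBr tprodA -!hsliceE.
by [].
Qed.

Lemma eq_rrekY k c c' r r' : (forall l, (l < k)%N -> c l = c' l) ->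
  (forall l, (l < k)%N -> r l = r' l) ->
  rrekY A B f alpha_c alpha_r Y0 c r k = rrekY A B f alpha_c alpha_r Y0 c' r' k.
Proof.
elim: k => [//|k IH cc rr]; rewrite 2!rrekYS /rrekX IH.
- by rewrite (eq_rrekZ cc) (rr _ (ltnSn k)).
- by move=> l lk; apply: cc; exact: ltnW.
- by move=> l lk; apply: rr; exact: ltnW.
Qed.

Lemma rrekZ_range V k c : tprod (ttr A) V = 0 ->
  (exists U, B - V = tprod A U) ->
  exists U, rrekZ A B alpha_c c k - V = tprod A U.
Proof.
move=> V0 BV; elim: k => [//|k IH].
by rewrite rrekZS col_stepB//; exact: col_step_range.
Qed.

Lemma rrekY_range k c r : range_tr A Y0 ->
  range_tr A (rrekY A B f alpha_c alpha_r Y0 c r k).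
Proof.
by move=> Yr; elim: k => [//|k IH]; rewrite rrekYS; exact: row_step_range.
Qed.

End Iterates.

(** A row step uses the column iterate already updated in the same round, so the perturbation
    carries b W_k; hence the exponents k - i run from 1 to k. *)
Lemma linear_recursion_le (R : realFieldType) (D W : nat -> R) (a b c : R) :
  0 <= a -> 0 <= b -> 0 <= c ->
  (forall k, W k.+1 <= b * W k) ->
  (forall k, D k.+1 <= a * D k + c * (b * W k)) ->
  forall k, D k <= c * W 0%N * (\sum_(0 <= i < k) b ^+ (k - i) * a ^+ i) +
    a ^+ k * D 0%N.
Proof.
move=> a0 b0 c0 hW hD.
have Wk k : W k <= b ^+ k * W 0%N.
  elim: k => [|k IH]; first by rewrite mul1r.
  by apply: le_trans (hW k) _; rewrite exprS -mulrA ler_wpM2l.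
elim=> [|k IH]; first by rewrite big_nil mulr0 add0r mul1r.
apply: le_trans (hD k) _.
apply: le_trans (lerD (ler_wpM2l a0 IH) (ler_wpM2l c0 (ler_wpM2l b0 (Wk k)))) _.
rewrite big_nat_recl// subn0 mulr1 le_eqVlt; apply/orP; left; apply/eqP.
have -> : \sum_(0 <= i < k) b ^+ (k.+1 - i.+1) * a ^+ i.+1 =
    a * \sum_(0 <= i < k) b ^+ (k - i) * a ^+ i.
  by rewrite mulr_sumr; apply: eq_bigr => i _; rewrite subSS exprS mulrCA.
by rewrite !exprS; ring.
Qed.

Theorem theorem3p2 (R : realType) (N1 N2 N3 K : nat)
  (A : tensor R N1.+1 N2.+1 N3.+1) (B : tensor R N1.+1 K.+1 N3.+1)
  (hA_r : forall i, hslice A i != 0) (hA_c : forall j, lslice A j != 0)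
  (f : tensor R N2.+1 K.+1 N3.+1 -> R) (gamma : R) (gamma_gt0 : 0 < gamma)
  (f_sc : strongly_convex gamma f) (f_adm : strongly_admissible A B f)
  (Xhat : tensor R N2.+1 K.+1 N3.+1) (hXhat : is_solution A B f Xhat)
  (nu : R) (nu_gt0 : 0 < nu)
  (hnu : forall X Z : tensor R N2.+1 K.+1 N3.+1,
    subdiff f X Z -> range_tr A Z ->
    bregman f Z X Xhat <= nu^-1 * tnormF (tprod A (X - Xhat)) ^+ 2)
  (alpha_c alpha_r : R)
  (h_alpha_c : 0 < alpha_c < 2 / lambda_c A)
  (h_alpha_r : 0 < alpha_r < 2 * gamma / lambda_r A)
  (Y0 : tensor R N2.+1 K.+1 N3.+1) (hY0 : range_tr A Y0)
  (d : measure_display) (Om : measurableType d) (P : probability Om R)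
  (cidx : nat -> Om -> 'I_N2.+1) (ridx : nat -> Om -> 'I_N1.+1)
  (h_sampling : rrek_sampling P A cidx ridx)
  (delta : R) (delta_gt0 : 0 < delta) (k : nat) :
  let Y k w := rrekY A B f alpha_c alpha_r Y0 (cidx ^~ w) (ridx ^~ w) k in
  let X k w := rrekX A B f alpha_c alpha_r Y0 (cidx ^~ w) (ridx ^~ w) k in
  let X0 := gradient (conjugate f) Y0 in
  let rho_c := 1 - (2 * alpha_c - alpha_c ^+ 2 * lambda_c A)
                   * sigma_min (bcirc A) ^+ 2 / tnormF A ^+ 2 in
  let rho_r := 1 - (2 * gamma * alpha_r - alpha_r ^+ 2 * lambda_r A) * nu
                   / (2 * gamma * tnormF A ^+ 2) in
  ('E_P[fun w => bregman f (Y k w) (X k w) Xhat] <=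
   ((delta + gamma) / (2 * delta * gamma)
      * (alpha_r ^+ 2 * lambda_r A / tnormF A ^+ 2)
      * tnormF (tprod (tprod A (tpinv A)) B) ^+ 2
      * \sum_(0 <= i < k)
          rho_c ^+ (k - i) * (1 + delta / gamma) ^+ i * rho_r ^+ i
    + (1 + delta / gamma) ^+ k * rho_r ^+ k * bregman f Y0 X0 Xhat)%:E)%E.
Proof.
move: k => N; set rc := 1 - _ * sigma_min _ ^+ 2 / _; set rr := 1 - _ * nu / _.
have A0 : A != 0.
  apply: contraNneq (hA_r ord0) => ->; apply/eqP.
  by rewrite hsliceE tprod0r.
pose B1 := tprod (tprod A (tpinv A)) B; pose V := B - B1.
have V0 : tprod (ttr A) V = 0 by rewrite tprodBr ttr_tprod_tpinv subrr.
have BV : B - V = B1 by rewrite opprB addrCA subrr addr0.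
have BVr : exists U, B - V = tprod A U.
  by exists (tprod (tpinv A) B); rewrite BV /B1 tprodA.
(* The difference lies in the range of A and is annihilated by the transpose of A, so it is
   orthogonal to itself. *)
have AX : tprod A Xhat = B1.
  apply/eqP; rewrite -subr_eq0 -tdot_eq0 {2}/B1 -tprodA -tprodBr tdotC.
  rewrite tdot_tprodl tprodBr ttr_tprod_tpinv tprodA; case: hXhat => -> _.
  by rewrite subrr tdot0r.
have [hc hr hi] := h_sampling.
pose p j := tnormF (lslice A j) ^+ 2 / tnormF A ^+ 2.
pose q i := tnormF (hslice A i) ^+ 2 / tnormF A ^+ 2.
pose Z k c := rrekZ A B alpha_c c k - V.
pose Yk k c r := rrekY A B f alpha_c alpha_r Y0 c r k.
pose WF k (c : nat -> 'I_N2.+1) (r : nat -> 'I_N1.+1) := tdot (Z k c) (Z k c).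
pose DF k c r :=
  bregman f (Yk k c r) (gradient (conjugate f) (Yk k c r)) Xhat.
have WFd k : determined k (WF k).
  by move=> c c' r r' cc _; rewrite /WF /Z (eq_rrekZ _ _ _ cc).
have DFd k : determined k (DF k).
  by move=> c c' r r' cc rr'; rewrite /DF /Yk (eq_rrekY _ _ _ _ _ _ cc rr').
have q1 : \sum_i q i = 1 := sum_law_r A0.
have p0 j : 0 <= p j by apply: divr_ge0; exact: sqr_ge0.
have updk n k (j : 'I_n.+1) c : update k j c k = j by rewrite /update eqxx.
have updl n k (j : 'I_n.+1) c l : (l < k)%N -> update k j c l = c l.
  by move=> lk; rewrite /update ltn_eqF.
have Zupd k c j : rrekZ A B alpha_c (update k j c) k = rrekZ A B alpha_c c k.
  by apply: eq_rrekZ => l; exact: updl.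
(* Since B - V = A * Xhat, the residual A * X - B + Z is A * (X - Xhat) plus the shifted column
   iterate Z - V. *)
have Yupd k c r j i : Yk k.+1 (update k j c) (update k i r) =
    row_step A alpha_r (Yk k c r) (tprod A (gradient (conjugate f) (Yk k c r)
      - Xhat) + Z k.+1 (update k j c)) i.
  rewrite /Yk rrekYS /rrekX updk.
  rewrite (eq_rrekY A B f alpha_c alpha_r Y0 (updl _ k j c) (updl _ k i r)).
  rewrite tprodBr AX /Z.
  have -> (T S : tensor R N1.+1 K.+1 N3.+1) : T - B1 + (S - V) = T - B + S.
    by rewrite -BV opprB addrACA [V - B - V]addrAC subrr add0r addrAC.
  by [].
have meanW k c : \sum_j p j * tdot (Z k.+1 (update k j c)) (Z k.+1 (update k j c))
    <= rc * tdot (Z k c) (Z k c).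
  have [U ZU] := rrekZ_range alpha_c k c V0 BVr.
  rewrite /Z; under eq_bigr => j _ do
    rewrite rrekZS Zupd updk col_stepB// ZU.
  by rewrite ZU; exact: mean_col_step_le.
have [U1 U1A] := exists_tprod_neq0 K A0.
have rc0 : 0 <= rc by exact: rho_c_ge0 U1A h_alpha_c.
have tA0 : ttr A != 0.
  by apply: contraNneq A0 => tA; rewrite -[A]ttrK tA; apply/eqP;
    apply: frontalP => k'; rewrite frontal_ttr !frontal0 trmx0.
have [U2 U2A] := exists_tprod_neq0 K tA0.
have rr0 : 0 <= rr.
  exact: (rho_r_ge0 hA_r A0 gamma_gt0 f_sc nu_gt0 h_alpha_r hnu U2A).
pose a := (1 + delta / gamma) * rr.
pose kap := (delta + gamma) / (2 * delta * gamma) *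
  (alpha_r ^+ 2 * lambda_r A / tnormF A ^+ 2).
have a0 : 0 <= a by rewrite mulr_ge0// addr_ge0// divr_ge0// ltW.
have kap0 : 0 <= kap.
  rewrite mulr_ge0//; first by rewrite divr_ge0 ?addr_ge0 ?mulr_ge0// ltW.
  apply: divr_ge0; last exact: sqr_ge0.
  by apply: mulr_ge0; [exact: sqr_ge0|exact: bigmax_ge_id].
pose PM := path_mean P cidx ridx.
have stepW k : PM k.+1 (WF k.+1) <= rc * PM k (WF k).
  rewrite /PM (path_meanS hc hr hi (WFd _)).
  have -> : rc * path_mean P cidx ridx k (WF k) =
      path_mean P cidx ridx k (fun c r => rc * WF k c r + 0 * WF k c r).
    by rewrite path_mean_lin mul0r addr0.
  apply: path_mean_le => c r; rewrite mul0r addr0.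
  (* The column iterate ignores the row draw, whose weights sum to 1. *)
  apply: le_trans (meanW k c); rewrite le_eqVlt; apply/orP; left; apply/eqP.
  by apply: eq_bigr => j _; rewrite -/(p j) -mulr_suml q1 mul1r.
have stepD k : PM k.+1 (DF k.+1) <= a * PM k (DF k) + kap * (rc * PM k (WF k)).
  rewrite /PM (path_meanS hc hr hi (DFd _)) mulrA -path_mean_lin.
  apply: path_mean_le => c r.
  (* The row draw is averaged first, with the column draw j fixed; [meanW] then averages over j. *)
  apply: (@le_trans _ _ (\sum_j p j * (a * DF k c r +
    kap * tdot (Z k.+1 (update k j c)) (Z k.+1 (update k j c))))).
    apply: ler_sum => j _; apply: (ler_wpM2l (p0 j)).
    have Yr : range_tr A (Yk k c r) by exact: rrekY_range.
    have := mean_row_step_le hA_r A0 gamma_gt0 f_sc nu_gt0 h_alpha_r hnu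
      (Z k.+1 (update k j c)) delta_gt0 Yr.
    move=> h; apply: le_trans h; rewrite le_eqVlt; apply/orP; left; apply/eqP.
    by apply: eq_bigr => i _; rewrite /DF Yupd.
  under eq_bigr do rewrite mulrDr.
  rewrite big_split/= -mulr_suml.
  have p1 : \sum_j p j = 1 := sum_law_c A0.
  rewrite p1 mul1r lerD2l.
  under eq_bigr do rewrite mulrCA.
  by rewrite -mulr_sumr -mulrA ler_wpM2l.
cbv beta zeta.
rewrite (expectation_path hc hr (DFd N)) lee_fin.
have := linear_recursion_le a0 rc0 kap0 stepW stepD N.
rewrite /PM (path_mean0 hc hr (fun=> ord0) (fun=> ord0) (WFd 0)).
rewrite (path_mean0 hc hr (fun=> ord0) (fun=> ord0) (DFd 0)).
(* The initial column error is B - V = B1, the source of the constant |A * A^+ * B|^2. *)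
rewrite /WF /Z /= BV -tnormF_sqr => /le_trans; apply.
rewrite /a exprMn /kap le_eqVlt; apply/orP; left; apply/eqP.
congr (_ * _ + _); apply: eq_bigr => i _.
by rewrite exprMn mulrA.
Qed.
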